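(* Let $\pi:M(c)\to N$ be an anti-invariant submersion from a quaternionic space form $(M(c),g_M)$ onto a Riemannian manifold $(N,g_N)$, let $\ell=\dim(\ker\pi_* )^\perp$ and let $\{X_1,\dots,X_\ell\}$ be a local orthonormal frame of the horizontal distribution. Then $$\tau^*\ \le\ \frac c4\Big\{\ell(\ell-1)+\sum_{i=1}^{\ell}\sum_{\alpha=1}^3 3\,\|C_{J_\alpha}X_i\|^2\Big\}.$$ Equality holds (at every point) if and only if the horizontal distribution $\mathcal H$ is integrable.
   Context: An almost quaternionic Hermitian manifold $(M,E,g_M)$ is a $4m$-dimensional Riemannian manifold with a rank 3 subbundle $E\subset \mathrm{End}(TM)$ having, near each point, a local basis $\{J_1,J_2,J_3\}$ of sections with $J_\alpha^2=-\mathrm{id}$, $J_\alpha J_{\alpha+1}=-J_{\alpha+1}J_\alpha=J_{\alpha+2}$ (indices mod 3) and $g_M(J_\alpha X,J_\alpha Y)=g_M(X,Y)$. It is quaternionic Kähler if there are local 1-forms $\omega_1,\omega_2,\omega_3$ with $\nabla_XJ_\alpha=\omega_{\alpha+2}(X)J_{\alpha+1}-\omega_{\alpha+1}(X)J_{\alpha+2}$, $\nabla$ the Levi-Civita connection. A quaternionic space form $M(c)$ ($c\in\mathbb R$) is a quaternionic Kähler manifold whose curvature tensor is $$R(X,Y)Z=\tfrac c4\Big\{g_M(Y,Z)X-g_M(X,Z)Y+\sum_{\alpha=1}^3\big(g_M(J_\alpha Y,Z)J_\alpha X-g_M(J_\alpha X,Z)J_\alpha Y+2g_M(J_\alpha Y,X)J_\alpha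 Z\big)\Big\}.$$ A Riemannian submersion $\pi:(M,g_M)\to(N,g_N)$ ($\dim M>\dim N$) is a smooth surjective map of maximal rank whose differential restricted to $(\ker\pi_* )^\perp$ is a linear isometry. Write $\mathcal V=\ker\pi_*$ (vertical), $\mathcal H=(\ker\pi_* )^\perp$ (horizontal), and use the same letters for the orthogonal projections. The submersion $\pi$ is anti-invariant if $J_\alpha(\ker\pi_* )\subset(\ker\pi_* )^\perp$ for $\alpha=1,2,3$. For horizontal $X$ write $J_\alpha X=B_{J_\alpha}X+C_{J_\alpha}X$ with $B_{J_\alpha}X$ vertical and $C_{J_\alpha}X$ horizontal; $\|C_{J_\alpha}X_i\|^2=\sum_{j=1}^\ell g_M(C_{J_\alpha}X_i,X_j)^2$. O'Neill tensor: $\mathcal A_EF=\mathcal H\nabla_{\mathcal HE}\mathcal VF+\mathcal V\nabla_{\mathcal HE}\mathcal HF$. The horizontal distribution is integrable iff $\mathcal A$ vanishes identically. Curvature convention: $R(X,Y,Z,W)=g_M(R(X,Y)Z,W)$, and the curvature tensor $R^*$ of the horizontal distribution (the horizontal lift of the curvature tensor $R'$ of $N$: $\pi_*(R^*(X,Y)Z)=R'(\pi_*X,\pi_*Y)\pi_*Z$) is related to $R$ by $$R(X,Y,Z,W)=R^*(X,Y,Z,W)-2g_M(\mathcal A_XY,\mathcal A_ZW)+g_M(\mathcal A_YZ,\mathcal A_XW)-g_M(\mathcal A_XZ,\mathcal A_YW)$$ for horizontal $X,Y,Z,W$; the sign of the curvature tensors is the one for which this holds, i.e. $R(X,Y)Z=\nabla_{[X,Y]}Z-\nabla_X\nabla_YZ+\nabla_Y\nabla_XZ$.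 Finally $Ric^*(X)=\sum_{j=1}^\ell R^*(X,X_j,X_j,X)$ and $\tau^*=\sum_{i=1}^\ell Ric^*(X_i)$. *)

(* Defs.v *)
From HB Require Import structures.
From mathcomp Require Import all_boot all_order all_algebra.
From mathcomp Require Import all_classical all_reals all_analysis.

Set Implicit Arguments.
Unset Strict Implicit.
Unset Printing Implicit Defensive.

Import Order.TTheory GRing.Theory Num.Theory numFieldNormedType.Exports.

Local Open Scope classical_set_scope.
Local Open Scope ring_scope.

(* On an open set U of a finite-dimensional space, f is C^(k+1) iff it is
   (Frechet) differentiable on U and all its directional derivatives are C^k. *)
Fixpoint Ck_on (R : realType) (V W : normedModType R) (k : nat) (U : set V)
    (f : V -> W) : Prop :=
  match k with
  | 0 => forall x, U x -> {for x, continuous f}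
  | k'.+1 => (forall x, U x -> differentiable f x) /\
             (forall v : V, Ck_on k' U (fun x => 'd f x v))
  end.

Definition smooth_on (R : realType) (V W : normedModType R) (U : set V)
  (f : V -> W) : Prop := forall k, Ck_on k U f.

(* A smooth n-dimensional manifold.  The smooth structure is given by an atlas
   indexed by the points: [chart p] is a chart with domain [cdom p], containing
   p, and with inverse [cinv p]. *)
Record manifold (R : realType) (n : nat) := Manifold {
  points :> topologicalType;
  chart : points -> points -> 'rV[R]_n;
  cdom : points -> set points;
  cinv : points -> 'rV[R]_n -> points;
  manifold_hausdorff : hausdorff_space points;
  manifold_countable : @second_countable points;
  cdom_open : forall p, open (cdom p);
  cdom_self : forall p, cdom p p;
  cimage_open : forall p, open (chart p @` cdom p);
  chartK : forall p q, cdom p q -> cinv p (chart p q) = q;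
  chart_continuous : forall p q, cdom p q -> {for q, continuous (chart p)};
  cinv_continuous : forall p x,
    (chart p @` cdom p) x -> {for x, continuous (cinv p)};
  transition_smooth : forall p q,
    smooth_on (chart p @` (cdom p `&` cdom q)) (chart q \o cinv p)
}.

(* The tangent space at p is 'rV[R]_n, a tangent vector v at p being identified
   with its components in the chart [chart p]: v acts on functions near p by
   v f = [tder p v f].  A (possibly only locally meaningful) vector field is a
   function M -> 'rV[R]_n; its components in another chart [chart q] are
   p |-> tder p (X p) (chart q). *)
Definition tder (R : realType) (n : nat) (M : manifold R n)
    (W : normedModType R) (p : M) (v : 'rV[R]_n) (f : M -> W) : W :=
  'd (f \o cinv p) (chart p p) v.

Definition fsmooth (R : realType) (n : nat) (M : manifold R n)
    (W : normedModType R) (U : set M) (f : M -> W) : Prop :=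
  forall q, smooth_on (chart q @` (cdom q `&` U)) (f \o cinv q).

Definition vsmooth (R : realType) (n : nat) (M : manifold R n) (U : set M)
    (X : M -> 'rV[R]_n) : Prop :=
  forall q, fsmooth (U `&` cdom q) (fun p => tder p (X p) (chart q)).

(* [X, Y] at p, through the components of X and Y in [chart p]. *)
Definition lie (R : realType) (n : nat) (M : manifold R n)
    (X Y : M -> 'rV[R]_n) (p : M) : 'rV[R]_n :=
  tder p (X p) (fun q => tder q (Y q) (chart p)) -
  tder p (Y p) (fun q => tder q (X q) (chart p)).

(* The vector field sum_i u_i d/dx^i of the coordinates x = [chart p], which
   extends u : T_p M to [cdom p]. *)
Definition coord_field (R : realType) (n : nat) (M : manifold R n) (p : M)
    (u : 'rV[R]_n) (q : M) : 'rV[R]_n :=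
  'd (chart q \o cinv p) (chart p q) u.

Definition smooth_map (R : realType) (n k : nat) (M : manifold R n)
    (N : manifold R k) (f : M -> N) : Prop :=
  continuous f /\
  forall p q, smooth_on (chart p @` (cdom p `&` f @^-1` cdom q))
                        (chart q \o f \o cinv p).

Definition tmap (R : realType) (n k : nat) (M : manifold R n)
    (N : manifold R k) (f : M -> N) (p : M) : 'Hom('rV[R]_n, 'rV[R]_k) :=
  linfun (fun v => tder p v (chart (f p) \o f)).

Definition riemannian_metric (R : realType) (n : nat) (M : manifold R n)
    (g : M -> 'rV[R]_n -> 'rV[R]_n -> R) : Prop :=
  [/\ forall p u v, g p u v = g p v u,
      forall p a u v w, g p (a *: u + v) w = a * g p u w + g p v w,
      forall p u, u != 0 -> 0 < g p u u &
      forall U X Y, open U -> vsmooth U X -> vsmooth U Y ->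
        fsmooth U (fun p => g p (X p) (Y p) : R^o)].

(* D p v Y stands for the covariant derivative at p of the vector field Y
   (smooth near p) along v : T_p M. *)
Record levi_civita (R : realType) (n : nat) (M : manifold R n)
    (g : M -> 'rV[R]_n -> 'rV[R]_n -> R)
    (D : M -> 'rV[R]_n -> (M -> 'rV[R]_n) -> 'rV[R]_n) : Prop := LeviCivita {
  lc_local : forall (U : set M) Y Z p v, open U -> vsmooth U Y ->
    (forall q, U q -> Y q = Z q) -> U p -> D p v Y = D p v Z;
  lc_smooth : forall (U : set M) X Y, open U -> vsmooth U X -> vsmooth U Y ->
    vsmooth U (fun p => D p (X p) Y);
  lc_linear : forall (U : set M) Y p a u v, open U -> vsmooth U Y -> U p ->
    D p (a *: u + v) Y = a *: D p u Y + D p v Y;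
  lc_add : forall (U : set M) Y Z p v, open U -> vsmooth U Y -> vsmooth U Z ->
    U p -> D p v (fun q => Y q + Z q) = D p v Y + D p v Z;
  lc_leibniz : forall (U : set M) (f : M -> R^o) Y p v, open U ->
    fsmooth U f -> vsmooth U Y -> U p ->
    D p v (fun q => (f q : R) *: Y q) =
      (tder p v f : R) *: Y p + (f p : R) *: D p v Y;
  lc_metric : forall (U : set M) Y Z p v, open U ->
    vsmooth U Y -> vsmooth U Z -> U p ->
    tder p v (fun q => g q (Y q) (Z q) : R^o) =
      g p (D p v Y) (Z p) + g p (Y p) (D p v Z);
  lc_torsion_free : forall (U : set M) X Y p, open U ->
    vsmooth U X -> vsmooth U Y -> U p ->
    D p (X p) Y - D p (Y p) X = lie X Y p
}.

(* R(X, Y)Z at p, with O'Neill's sign. *)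
Definition curvature_field (R : realType) (n : nat) (M : manifold R n)
    (D : M -> 'rV[R]_n -> (M -> 'rV[R]_n) -> 'rV[R]_n)
    (X Y Z : M -> 'rV[R]_n) (p : M) : 'rV[R]_n :=
  D p (lie X Y p) Z - D p (X p) (fun q => D q (Y q) Z)
                    + D p (Y p) (fun q => D q (X q) Z).

(* R(x, y)z for x, y, z : T_p M.  The curvature being tensorial, any local
   extensions of x, y, z give the same value; coordinate ones are used. *)
Definition curvature (R : realType) (n : nat) (M : manifold R n)
    (D : M -> 'rV[R]_n -> (M -> 'rV[R]_n) -> 'rV[R]_n)
    (p : M) (x y z : 'rV[R]_n) : 'rV[R]_n :=
  curvature_field D (coord_field p x) (coord_field p y) (coord_field p z) p.

(* J is an admissible basis over U of the bundle E of endomorphisms.  Indices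
   are in 'I_3 = Z/3, so that alpha = 1, 2, 3 become 0, 1, 2 mod 3. *)
Record admissible_basis (R : realType) (n : nat) (M : manifold R n)
    (g : M -> 'rV[R]_n -> 'rV[R]_n -> R) (E : M -> {vspace 'End('rV[R]_n)})
    (U : set M) (J : 'I_3 -> M -> 'End('rV[R]_n)) : Prop := AdmissibleBasis {
  ab_smooth : forall a V X, open V -> V `<=` U -> vsmooth V X ->
    vsmooth V (fun p => J a p (X p));
  ab_basis : forall p, U p -> basis_of (E p) [tuple J a p | a < 3];
  ab_square : forall p a v, U p -> J a p (J a p v) = - v;
  ab_mul : forall p a v, U p -> J a p (J (a + 1) p v) = J (a + 2) p v;
  ab_anti : forall p a v, U p -> J (a + 1) p (J a p v) = - J (a + 2) p v;
  ab_hermitian : forall p a u v, U p -> g p (J a p u) (J a p v) = g p u v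
}.

Definition almost_quaternionic_hermitian (R : realType) (n : nat)
    (M : manifold R n) (g : M -> 'rV[R]_n -> 'rV[R]_n -> R)
    (E : M -> {vspace 'End('rV[R]_n)}) : Prop :=
  riemannian_metric g /\
  forall p : M, exists U J, [/\ open U, U p & admissible_basis g E U J].

Definition one_form (R : realType) (n : nat) (M : manifold R n) (U : set M)
    (w : M -> 'rV[R]_n -> R) : Prop :=
  (forall p a u v, U p -> w p (a *: u + v) = a * w p u + w p v) /\
  (forall V X, open V -> V `<=` U -> vsmooth V X ->
     fsmooth V (fun p => w p (X p) : R^o)).

(* (nabla_v J) Y = nabla_v (J Y) - J (nabla_v Y), for J a field of
   endomorphisms. *)
Definition quaternionic_kahler (R : realType) (n : nat)
    (M : manifold R n) (g : M -> 'rV[R]_n -> 'rV[R]_n -> R)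
    (D : M -> 'rV[R]_n -> (M -> 'rV[R]_n) -> 'rV[R]_n)
    (E : M -> {vspace 'End('rV[R]_n)}) : Prop :=
  [/\ almost_quaternionic_hermitian g E, levi_civita g D &
      forall U J, open U -> admissible_basis g E U J ->
        exists w : 'I_3 -> M -> 'rV[R]_n -> R,
          (forall a, one_form U (w a)) /\
          forall a p v V Y, open V -> V `<=` U -> V p -> vsmooth V Y ->
            D p v (fun q => J a q (Y q)) - J a p (D p v Y) =
            w (a + 2) p v *: J (a + 1) p (Y p) -
            w (a + 1) p v *: J (a + 2) p (Y p)].

Definition quaternionic_space_form (R : realType) (n : nat)
    (M : manifold R n) (g : M -> 'rV[R]_n -> 'rV[R]_n -> R)
    (D : M -> 'rV[R]_n -> (M -> 'rV[R]_n) -> 'rV[R]_n)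
    (E : M -> {vspace 'End('rV[R]_n)}) (c : R) : Prop :=
  quaternionic_kahler g D E /\
  forall U J p x y z, open U -> admissible_basis g E U J -> U p ->
    curvature D p x y z =
    (c / 4) *: (g p y z *: x - g p x z *: y +
      \sum_(a < 3) (g p (J a p y) z *: J a p x - g p (J a p x) z *: J a p y +
                    (2 * g p (J a p y) x) *: J a p z)).

(* The orthogonal complement of U for a bilinear form b. *)
Definition orthv (R : realType) (n : nat) (b : 'rV[R]_n -> 'rV[R]_n -> R)
    (U : {vspace 'rV[R]_n}) : {vspace 'rV[R]_n} :=
  (\bigcap_(u <- vbasis U) lker (linfun (fun v => b u v : R^o)))%VS.

Definition ver (R : realType) (n k : nat) (M : manifold R n)
    (N : manifold R k) (f : M -> N) (p : M) : {vspace 'rV[R]_n} :=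
  lker (tmap f p).

Definition hor (R : realType) (n k : nat) (M : manifold R n)
    (N : manifold R k) (g : M -> 'rV[R]_n -> 'rV[R]_n -> R) (f : M -> N)
    (p : M) : {vspace 'rV[R]_n} :=
  orthv (g p) (ver f p).

Definition hproj (R : realType) (n k : nat) (M : manifold R n)
    (N : manifold R k) (g : M -> 'rV[R]_n -> 'rV[R]_n -> R) (f : M -> N)
    (p : M) : 'End('rV[R]_n) :=
  daddv_pi (hor g f p) (ver f p).

(* The horizontal vector at p lying over w : T_(f p) N; (tmap f p)^-1 is a
   linear section of tmap f p. *)
Definition hlift (R : realType) (n k : nat) (M : manifold R n)
    (N : manifold R k) (g : M -> 'rV[R]_n -> 'rV[R]_n -> R) (f : M -> N)
    (p : M) (w : 'rV[R]_k) : 'rV[R]_n :=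
  hproj g f p ((tmap f p)^-1%VF w).

Definition riemannian_submersion (R : realType) (n k : nat)
    (M : manifold R n) (N : manifold R k)
    (gM : M -> 'rV[R]_n -> 'rV[R]_n -> R)
    (gN : N -> 'rV[R]_k -> 'rV[R]_k -> R) (f : M -> N) : Prop :=
  [/\ (k < n)%N,
      smooth_map f,
      range f = setT,
      forall p, limg (tmap f p) = fullv &
      forall p u v, u \in hor gM f p -> v \in hor gM f p ->
        gN (f p) (tmap f p u) (tmap f p v) = gM p u v].

Definition anti_invariant (R : realType) (n k : nat)
    (M : manifold R n) (N : manifold R k)
    (g : M -> 'rV[R]_n -> 'rV[R]_n -> R) (E : M -> {vspace 'End('rV[R]_n)})
    (f : M -> N) : Prop :=
  forall U J p a, open U -> admissible_basis g E U J -> U p ->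
    (J a p @: ver f p <= hor g f p)%VS.

(* Integrability in the sense of involutivity. *)
Definition horizontal_integrable (R : realType) (n k : nat)
    (M : manifold R n) (N : manifold R k)
    (g : M -> 'rV[R]_n -> 'rV[R]_n -> R) (f : M -> N) : Prop :=
  forall (U : set M) X Y, open U -> vsmooth U X -> vsmooth U Y ->
    (forall p, U p -> X p \in hor g f p) ->
    (forall p, U p -> Y p \in hor g f p) ->
    forall p, U p -> lie X Y p \in hor g f p.

Definition horizontal_frame (R : realType) (n k l : nat)
    (M : manifold R n) (N : manifold R k)
    (g : M -> 'rV[R]_n -> 'rV[R]_n -> R) (f : M -> N) (U : set M)
    (X : 'I_l -> M -> 'rV[R]_n) : Prop :=
  (forall i, vsmooth U (X i)) /\
  forall p, U p ->
    (forall i, X i p \in hor g f p) /\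
    (forall i j, g p (X i p) (X j p) = (i == j)%:R).

(* R^*(x, y)z: the horizontal lift of the curvature of the base. *)
Definition hcurvature (R : realType) (n k : nat)
    (M : manifold R n) (N : manifold R k)
    (g : M -> 'rV[R]_n -> 'rV[R]_n -> R)
    (DN : N -> 'rV[R]_k -> (N -> 'rV[R]_k) -> 'rV[R]_k) (f : M -> N)
    (p : M) (x y z : 'rV[R]_n) : 'rV[R]_n :=
  hlift g f p (curvature DN (f p) (tmap f p x) (tmap f p y) (tmap f p z)).

Definition hricci (R : realType) (n k l : nat)
    (M : manifold R n) (N : manifold R k)
    (g : M -> 'rV[R]_n -> 'rV[R]_n -> R)
    (DN : N -> 'rV[R]_k -> (N -> 'rV[R]_k) -> 'rV[R]_k) (f : M -> N)
    (X : 'I_l -> M -> 'rV[R]_n) (p : M) (x : 'rV[R]_n) : R :=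
  \sum_(j < l) g p (hcurvature g DN f p x (X j p) (X j p)) x.

Definition hscalar (R : realType) (n k l : nat)
    (M : manifold R n) (N : manifold R k)
    (g : M -> 'rV[R]_n -> 'rV[R]_n -> R)
    (DN : N -> 'rV[R]_k -> (N -> 'rV[R]_k) -> 'rV[R]_k) (f : M -> N)
    (X : 'I_l -> M -> 'rV[R]_n) (p : M) : R :=
  \sum_(i < l) hricci g DN f X p (X i p).

(* ||C_J x||^2, where C_J x is the horizontal part of J x. *)
Definition normC2 (R : realType) (n k l : nat)
    (M : manifold R n) (N : manifold R k)
    (g : M -> 'rV[R]_n -> 'rV[R]_n -> R) (f : M -> N)
    (X : 'I_l -> M -> 'rV[R]_n) (J : M -> 'End('rV[R]_n)) (p : M)
    (x : 'rV[R]_n) : R :=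
  \sum_(j < l) g p (hproj g f p (J p x)) (X j p) ^+ 2.

(* Main.v *)
(* The inequality is O'Neill's formula for the sectional curvatures of a
   Riemannian submersion F, summed over a horizontal frame: for horizontal u, v,
     <R(u, v)v, u> - <R'(F_* u, F_* v) F_* v, F_* u> = 3/4 |V[u, v]|^2,
   where V[u, v] is the vertical part of the bracket of horizontal extensions.
   It is proved in charts through the second fundamental form
     B(u, v) = D^2 F(u, v) + Gamma'(DF u, DF v) - DF Gamma(u, v).
   Differentiating the identity h(DF u, DF v) = g(P u, v), with P the horizontal
   projection, shows that B vanishes on horizontal vectors and that
   h(B(w, a), DF z) = g(a, A_w z) for vertical a and horizontal w, z, where
   A_w z is the vertical part of nabla_w (P z) and is skew in w, z.  The
   commutator of covariant derivatives of B is DF R - R' (Ricci identity), and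
   its horizontal part is computed by differentiating B(P u, P v) = 0.
   Since V[u, v] is tensorial, equality at every point means that it vanishes on
   one orthonormal horizontal frame near each point, hence that the bracket of
   any horizontal fields is horizontal. *)
Require Import Defs.
From HB Require Import structures.
From mathcomp Require Import all_boot all_order all_algebra.
From mathcomp Require Import all_classical all_reals all_analysis.
From mathcomp Require Import zify ring lra.

Set Implicit Arguments.
Unset Strict Implicit.
Unset Printing Implicit Defensive.

Import Order.TTheory GRing.Theory Num.Theory numFieldNormedType.Exports.

Local Open Scope classical_set_scope.
Local Open Scope ring_scope.

(** * Differentials *)

Section Differentials.
Context {R : realType}.
Implicit Types V W Z : normedModType R.

(** A tangent vector is stored in the chart attached to its own base point, so the raw components of
    a smooth field need not even be continuous; derivatives are meaningful only after transport to
    one fixed chart. There [B] needs nothing but derivatives of the coordinate expression of the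
    submersion and the two Christoffel maps, whereas an argument with horizontal lifts would need
    fields along the map, on which neither connection acts. The constant: write A for the vertical
    part of the covariant derivative, so that V[u, v] = 2 A_u v by skewness. The horizontal part of
    the Ricci identity gives |A_u v|^2 from the covariant derivatives and <V[u, v], A_u v> = 2 |A_u
    v|^2 from the bracket, in total 3 |A_u v|^2 = 3/4 |V[u, v]|^2. The space form makes the
    sectional curvatures of the total space explicit, so the right side of the inequality minus the
    left is 3/4 of the sum of all |V[X_i, X_j]|^2, whatever the sign of c; the inequality and its
    equality case are both read off from this identity. *)

Definition has_diff V W (f : V -> W) (x : V) (df : V -> W) :=
  differentiable f x /\ 'd f x = df :> (V -> W).

Lemma has_diffP V W (f : V -> W) x :
  differentiable f x -> has_diff f x ('d f x).
Proof. by move=> h; split. Qed.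

(** The derivative is carried as a plain function: the rules build it up syntactically and this
    lemma normalises the result pointwise. *)
Lemma has_diff_eq V W (f : V -> W) x df dg :
  has_diff f x df -> df =1 dg -> has_diff f x dg.
Proof. by move=> [h <-] /funext <-; split. Qed.

Lemma has_diff_near0 V W (h : V -> W) x :
  (\near x, h x = 0) -> has_diff h x 0.
Proof.
move=> h0.
have hx0 : h x = 0 by exact: nbhs_singleton h0.
have d0 : 'd (cst 0 : V -> W) x = 0 :> (V -> W) by exact: diff_cst.
have E : h \o shift x = cst (h x) + 'd (cst 0 : V -> W) x +o_ 0 id.
  apply/eqaddoP => _/posnumP[e]; near=> y.
  rewrite d0 !fctE /= hx0 addr0 subr0.
  have -> : h (y + x) = 0.
    near: y.
    by move: h0; rewrite (near_shift 0 x) /=; apply: filterS => z /=;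
      rewrite subr0.
  by rewrite normr0 mulr_ge0.
have c0 : continuous ('d (cst 0 : V -> W) x)
  by exact/diff_continuous/differentiable_cst.
have dh : 'd h x = 0 :> (V -> W) by rewrite -d0; exact: diff_unique.
split; last exact: dh.
apply/diff_locallyP; rewrite dh -d0; split; [exact: c0|exact: E].
Unshelve. all: by end_near. Qed.

Lemma has_diff_cst V W (a : W) (x : V) : has_diff (cst a) x (fun=> 0).
Proof. by split; [exact: differentiable_cst | exact: diff_cst]. Qed.

Lemma has_diffD V W (f g df dg : V -> W) x :
  has_diff f x df -> has_diff g x dg ->
  has_diff (fun y => f y + g y) x (fun v => df v + dg v).
Proof.
move=> [f1 <-] [g1 <-]; split; first exact: (differentiableD f1 g1).
exact: (diffD f1 g1).
Qed.

(** Adding [g - f], which vanishes near [x], reduces the claim to [has_diff_near0]. *)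
Lemma has_diff_near V W (f g df : V -> W) x :
  (\near x, f x = g x) -> has_diff f x df -> has_diff g x df.
Proof.
move=> fg hf.
have h0 : has_diff (fun y => g y - f y) x 0.
  by apply: has_diff_near0; apply: filterS fg => y ->; rewrite subrr.
have := has_diffD hf h0.
have -> : (fun y => f y + (g y - f y)) = g.
  by apply/funext => y; rewrite addrC subrK.
by move=> h; apply: has_diff_eq h _ => v; rewrite addr0.
Qed.

Lemma has_diff_lin V W (f : {linear V -> W}) x :
  continuous f -> has_diff f x f.
Proof.
move=> cf; split; first exact: (linear_differentiable x cf).
exact: (diff_lin x cf).
Qed.

Lemma has_diff_comp V W Z (f df : V -> W) (g dg : W -> Z) x :
  has_diff f x df -> has_diff g (f x) dg ->
  has_diff (fun y => g (f y)) x (fun v => dg (df v)).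
Proof.
move=> [f1 <-] [g1 <-]; split; first exact: (differentiable_comp f1 g1).
exact: (diff_comp f1 g1).
Qed.

Lemma has_diff_id V (x : V) : has_diff id x id.
Proof. by apply: (@has_diff_lin _ _ idfun) => y. Qed.

Lemma has_diffN V W (f df : V -> W) x :
  has_diff f x df -> has_diff (fun y => - f y) x (fun v => - df v).
Proof.
move=> [f1 <-]; split; first exact: (differentiableN f1).
exact: (diffN f1).
Qed.

Lemma has_diffB V W (f g df dg : V -> W) x :
  has_diff f x df -> has_diff g x dg ->
  has_diff (fun y => f y - g y) x (fun v => df v - dg v).
Proof. by move=> hf hg; apply: has_diffD hf _; exact: has_diffN. Qed.

Lemma has_diff_sum V W (I : Type) (s : seq I) (f df : I -> V -> W) x :
  (forall i, has_diff (f i) x (df i)) ->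
  has_diff (fun y => \sum_(i <- s) f i y) x (fun v => \sum_(i <- s) df i v).
Proof.
move=> h; elim: s => [|i s IH].
  under eq_fun do rewrite big_nil.
  apply: has_diff_eq (has_diff_cst 0 x) _ => v; by rewrite big_nil.
under eq_fun do rewrite big_cons.
apply: has_diff_eq (has_diffD (h i) IH) _ => v; by rewrite big_cons.
Qed.

Lemma has_diff_pair V W Z (f df : V -> W) (g dg : V -> Z) x :
  has_diff f x df -> has_diff g x dg ->
  has_diff (fun y => (f y, g y)) x (fun v => (df v, dg v)).
Proof.
move=> [f1 <-] [g1 <-]; split; first exact: (differentiable_pair f1 g1).
exact: (diff_pair f1 g1).
Qed.

Lemma scaler_is_bilinear W :
  bilinear_for
    (GRing.Scale.Law.clone _ _ *:%R _) (GRing.Scale.Law.clone _ _ *:%R _)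
    (fun (a : R^o) (w : W) => (a : R) *: w).
Proof.
split=> [w|a] b u v /=; first by rewrite scalerDl scalerA.
by rewrite scalerDr !scalerA mulrC.
Qed.
Lemma has_diff_scale V W (f df : V -> R^o) (g dg : V -> W) x :
  has_diff f x df -> has_diff g x dg ->
  has_diff (fun y => (f y : R) *: g y) x
    (fun v => (df v : R) *: g x + (f x : R) *: dg v).
Proof.
move=> hf hg.
pose B := bilinear_isBilinear.Build R R^o W W _ _ _ (scaler_is_bilinear W).
pose b : {bilinear R^o -> W -> W} := HB.pack
  (fun (a : R^o) (w : W) => (a : R) *: w) B.
have cb : continuous (fun p : R^o * W => b p.1 p.2).
  by move=> p; exact: scale_continuous.
have hb p : has_diff (fun p : R^o * W => (p.1 : R) *: p.2) p
   (fun q => (p.1 : R) *: q.2 + (q.1 : R) *: p.2).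
  split; first exact: (differentiable_bilin p cb).
  exact: (diff_bilin p cb).
have := has_diff_comp (has_diff_pair hf hg) (hb (f x, g x)) => h.
by apply: has_diff_eq h _ => v /=; rewrite addrC.
Qed.

Lemma linear_rVE W n (f : 'rV[R]_n -> W) v :
  linear f -> f v = \sum_i v 0 i *: f (delta_mx 0 i).
Proof.
move=> lf; pose F : {linear _ -> _} := HB.pack f
  (GRing.isLinear.Build _ _ _ _ _ lf).
rewrite -[f]/(F : _ -> _) [in LHS](row_sum_delta v) linear_sum.
by apply: eq_bigr => i _; rewrite linearZ.
Qed.

Lemma has_diff_coord n (i : 'I_n) (x : 'rV[R]_n) :
  has_diff (fun v : 'rV[R]_n => v 0 i : R^o) x (fun v => v 0 i).
Proof.
have lc : linear (fun v : 'rV[R]_n => v 0 i : R^o) by move=> a u v;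
  rewrite !mxE.
pose F : {linear _ -> _} := HB.pack (fun v : 'rV[R]_n => v 0 i : R^o)
  (GRing.isLinear.Build _ _ _ _ _ lc).
apply: (@has_diff_lin _ _ F); exact: coord_continuous.
Qed.

(** Finite dimension replaces a continuity hypothesis: [f] is a finite sum of coordinate functions
    times fixed vectors. *)
Lemma has_diff_linear W n (f : 'rV[R]_n -> W) x : linear f -> has_diff f x f.
Proof.
move=> lf.
have -> : f = fun v => \sum_i (v 0 i : R) *: f (delta_mx 0 i).
  by apply/funext => v; exact: linear_rVE.
apply: has_diff_sum => i.
apply: has_diff_eq (has_diff_scale (has_diff_coord i x) (has_diff_cst _ x)) _
  => v /=.
by rewrite scaler0 addr0.
Qed.

Lemma has_diff_unique V W (f df dg : V -> W) x :
  has_diff f x df -> has_diff f x dg -> df =1 dg.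
Proof. by move=> [_ <-] [_ <-]. Qed.

Lemma has_diff_linearP V W (f df : V -> W) x : has_diff f x df -> linear df.
Proof. by move=> [_ <-] a u v; rewrite linearP. Qed.

Lemma diff_near V W (f g : V -> W) x : differentiable f x ->
  (\near x, f x = g x) -> 'd f x =1 'd g x.
Proof.
move=> df fg v; have [_ E] := has_diff_near fg (has_diffP df).
exact: (congr1 (@^~ v) (esym E)).
Qed.

Lemma has_diff_linear_family V W n (phi : V -> 'rV[R]_n -> W)
    (dphi : 'rV[R]_n -> V -> W) x u :
  (\near x, linear (phi x)) -> (forall v, has_diff (phi^~ v) x (dphi v)) ->
  linear (dphi^~ u).
Proof.
move=> lphi dphi_ a v w.
have h := has_diffD (has_diff_scale (has_diff_cst (a : R^o) x) (dphi_ v))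
  (dphi_ w).
have E : \near x, a *: phi x v + phi x w = phi x (a *: v + w).
  by apply: filterS lphi => z lz; rewrite lz.
have := has_diff_unique (dphi_ _) (has_diff_near E h) u.
by rewrite scale0r add0r.
Qed.

(** Expanding [Y] in the standard basis reduces this product rule to scalar multiplication, so [phi]
    only has to be differentiable at each fixed vector and no norm on linear maps is involved. *)
Lemma has_diff_lin_app V W n (phi : V -> 'rV[R]_n -> W)
    (dphi : 'rV[R]_n -> V -> W) (Y dY : V -> 'rV[R]_n) x :
  (\near x, linear (phi x)) -> (forall v, has_diff (phi^~ v) x (dphi v)) ->
  has_diff Y x dY ->
  has_diff (fun z => phi z (Y z)) x (fun u => dphi (Y x) u + phi x (dY u)).
Proof.
move=> lphi dphi_ hY.
have lx : linear (phi x) by exact: nbhs_singleton lphi.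
have ldphi u := has_diff_linear_family u lphi dphi_.
have E : \near x, \sum_i (Y x 0 i : R) *: phi x (delta_mx 0 i) = phi x (Y x).
  by apply: filterS lphi => z lz; rewrite -linear_rVE.
have H : has_diff (fun x => \sum_i (Y x 0 i : R) *: phi x (delta_mx 0 i)) x
   (fun u => \sum_i ((dY u 0 i : R) *: phi x (delta_mx 0 i) + (Y x 0 i : R) *:
     dphi (delta_mx 0 i) u)).
  apply: has_diff_sum => i.
  apply: (has_diff_scale (f := fun x => Y x 0 i)); last exact: dphi_.
  exact: (has_diff_comp hY (has_diff_coord i _)).
apply: has_diff_eq (has_diff_near E H) _ => u.
rewrite big_split /= -linear_rVE //.
by rewrite -(linear_rVE (f := dphi^~ u)) // addrC.
Qed.

Lemma has_diff_bilin_app V W n k (phi : V -> 'rV[R]_n -> 'rV[R]_k -> W)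
    (dphi : 'rV[R]_n -> 'rV[R]_k -> V -> W)
    (Y dY : V -> 'rV[R]_n) (Z dZ : V -> 'rV[R]_k) x :
  (\near x, (forall v, linear (phi x v)) /\ (forall v, linear (phi x ^~ v))) ->
  (forall v w, has_diff (fun z => phi z v w) x (dphi v w)) ->
  has_diff Y x dY -> has_diff Z x dZ ->
  has_diff (fun z => phi z (Y z) (Z z)) x
    (fun u => dphi (Y x) (Z x) u + phi x (dY u) (Z x) + phi x (Y x) (dZ u)).
Proof.
move=> lphi dphi_ hY hZ.
apply: (has_diff_lin_app (phi := fun z => phi z (Y z))
  (dphi := fun w u => dphi (Y x) w u + phi x (dY u) w)) => //.
  by apply: filterS lphi => z [].
move=> w; apply: (has_diff_lin_app (phi := fun z v => phi z v w)
  (dphi := fun v => dphi v w)) => //.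
by apply: filterS lphi => z [].
Qed.
End Differentials.

(** * Smooth functions *)

Section Smooth.
Context {R : realType}.
Implicit Types V W : normedModType R.

Lemma near_open (T : topologicalType) (U : set T) x :
  open U -> U x -> \near x, U x.
Proof. by move=> oU Ux; exact: open_nbhs_nbhs. Qed.

Lemma continuous_at_near (T T' : topologicalType) (f g : T -> T') x :
  (\near x, f x = g x) -> {for x, continuous f} -> {for x, continuous g}.
Proof.
move=> fg cf; rewrite /prop_for /continuous_at -(nbhs_singleton fg).
exact: cvg_trans (near_eq_cvg fg) cf.
Qed.

Lemma Ck_ext V W k (U : set V) (f g : V -> W) : open U ->
  (forall x, U x -> f x = g x) -> Ck_on k U f -> Ck_on k U g.
Proof.
move=> oU; elim: k f g => [|k IH] f g fg /=.
  move=> cf x Ux; apply: continuous_at_near (cf x Ux).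
  by apply: filterS (near_open oU Ux) => y; exact: fg.
move=> [df Cf]; have nfg x : U x -> \near x, f x = g x.
  by move=> Ux; apply: filterS (near_open oU Ux) => y; exact: fg.
split=> [x Ux|v]; first by have [] := has_diff_near (nfg _ Ux)
  (has_diffP (df _ Ux)).
apply: IH (Cf v) => x Ux; exact: diff_near (df _ Ux) (nfg _ Ux) v.
Qed.

Lemma CkS_intro V W k (U : set V) (f : V -> W) (df : V -> V -> W) : open U ->
  (forall x, U x -> has_diff f x (df x)) ->
  (forall v, Ck_on k U (fun x => df x v)) -> Ck_on k.+1 U f.
Proof.
move=> oU hf Cf; split=> [x Ux|v]; first by have [] := hf _ Ux.
by apply: Ck_ext (Cf v) => // x Ux; have [_ ->] := hf _ Ux.
Qed.

Lemma Ck_le V W k (U : set V) (f : V -> W) : Ck_on k.+1 U f -> Ck_on k U f.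
Proof.
elim: k f => [|k IH] f [df Cf].
  by move=> x Ux; apply: differentiable_continuous; exact: df.
by split=> // v; apply: IH.
Qed.

Lemma Ck_subset V W k (U U' : set V) (f : V -> W) :
  U' `<=` U -> Ck_on k U f -> Ck_on k U' f.
Proof.
move=> sU; elim: k f => [|k IH] f /=; first by move=> cf x /sU; exact: cf.
by move=> [df Cf]; split=> [x /sU|v]; [exact: df | exact: IH].
Qed.

Lemma CkS_diff V W k (U : set V) (f : V -> W) x :
  Ck_on k.+1 U f -> U x -> has_diff f x ('d f x).
Proof. by move=> [df _] Ux; apply: has_diffP; exact: df. Qed.

Lemma Ck_cst V W k (U : set V) (a : W) : open U -> Ck_on k U (fun=> a).
Proof.
move=> oU; elim: k a => [|k IH] a; first by move=> x _; exact: cst_continuous.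
by apply: (CkS_intro (df := fun _ _ => 0)) => // x _; exact: has_diff_cst.
Qed.

Lemma CkD V W k (U : set V) (f g : V -> W) : open U ->
  Ck_on k U f -> Ck_on k U g -> Ck_on k U (fun x => f x + g x).
Proof.
move=> oU; elim: k f g => [|k IH] f g.
  by move=> cf cg x Ux; apply: continuousD; [exact: cf | exact: cg].
move=> Cf Cg.
apply: (CkS_intro (df := fun x v => 'd f x v + 'd g x v)) => // [x Ux|v].
  exact: has_diffD (CkS_diff Cf Ux) (CkS_diff Cg Ux).
by apply: IH; [exact: Cf.2 | exact: Cg.2].
Qed.

Lemma Ck_sum V W k (U : set V) (I : Type) (s : seq I) (f : I -> V -> W) :
  open U -> (forall i, Ck_on k U (f i)) ->
  Ck_on k U (fun x => \sum_(i <- s) f i x).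
Proof.
move=> oU Cf; elim: s => [|i s IH].
  by under eq_fun do rewrite big_nil; exact: Ck_cst.
by under eq_fun do rewrite big_cons; exact: CkD.
Qed.

Lemma Ck_scale V W k (U : set V) (f : V -> R^o) (g : V -> W) : open U ->
  Ck_on k U f -> Ck_on k U g -> Ck_on k U (fun x => (f x : R) *: g x).
Proof.
move=> oU; elim: k f g => [|k IH] f g.
  by move=> cf cg x Ux; apply: continuousZ; [exact: cf | exact: cg].
move=> Cf Cg.
apply: (CkS_intro (df := fun x v => ('d f x v : R) *: g x + (f x : R) *: 'd g x
  v)) => // [x Ux|v].
  exact: has_diff_scale (CkS_diff Cf Ux) (CkS_diff Cg Ux).
apply: CkD => //; apply: IH; [exact: Cf.2 | exact: Ck_le | exact: Ck_le |
  exact: Cg.2].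
Qed.

Lemma CkN V W k (U : set V) (f : V -> W) : open U ->
  Ck_on k U f -> Ck_on k U (fun x => - f x).
Proof.
move=> oU Cf; apply: Ck_ext (Ck_scale oU (Ck_cst k (-1 : R^o) oU) Cf) => // x _.
by rewrite scaleN1r.
Qed.

Lemma CkB V W k (U : set V) (f g : V -> W) : open U ->
  Ck_on k U f -> Ck_on k U g -> Ck_on k U (fun x => f x - g x).
Proof. by move=> oU Cf Cg; apply: CkD => //; exact: CkN. Qed.

Lemma Ck_linear V W n k (U : set V) (f : V -> 'rV[R]_n) (L : 'rV[R]_n -> W) :
  open U -> linear L -> Ck_on k U f -> Ck_on k U (fun x => L (f x)).
Proof.
move=> oU lL; elim: k f => [|k IH] f.
  move=> cf x Ux; apply: continuous_comp; first exact: cf.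
  by apply: differentiable_continuous; have [] := has_diff_linear (f x) lL.
move=> Cf; apply: (CkS_intro (df := fun x v => L ('d f x v))) => // [x Ux|v].
  exact: has_diff_comp (CkS_diff Cf Ux) (has_diff_linear _ lL).
by apply: IH; exact: Cf.2.
Qed.

Lemma linear_coord n (i : 'I_n) : linear (fun v : 'rV[R]_n => v 0 i : R^o).
Proof. by move=> a u v; rewrite !mxE. Qed.

Lemma Ck_coord V n k (U : set V) (f : V -> 'rV[R]_n) i : open U ->
  Ck_on k U f -> Ck_on k U (fun x => f x 0 i : R^o).
Proof.
move=> oU; apply: (Ck_linear (L := fun v : 'rV_n => v 0 i : R^o)) => //.
exact: linear_coord.
Qed.

Lemma Ck_lin_app V W n k (U : set V) (phi : V -> 'rV[R]_n -> W)
    (Y : V -> 'rV[R]_n) : open U ->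
  (forall x, U x -> linear (phi x)) -> (forall v, Ck_on k U (phi^~ v)) ->
  Ck_on k U Y -> Ck_on k U (fun x => phi x (Y x)).
Proof.
move=> oU lphi Cphi CY.
apply: (Ck_ext (f := fun x => \sum_i (Y x 0 i : R) *: phi x (delta_mx 0 i))) =>
  //.
  by move=> x Ux; rewrite [RHS]linear_rVE //; exact: lphi.
by apply: Ck_sum => // i; apply: (Ck_scale (f := fun x => Y x 0 i)) => //;
  exact: Ck_coord.
Qed.

(** The derivative is ['d g (f x)] applied to ['d f x v]; for a fixed argument [w] the map
    ['d g (f x) w] is again a composite, one order lower, so induction applies. *)
Lemma Ck_comp V W n k (U : set V) (U' : set 'rV[R]_n) (f : V -> 'rV[R]_n)
    (g : 'rV[R]_n -> W) : open U -> open U' -> (forall x, U x -> U' (f x)) ->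
  Ck_on k U f -> Ck_on k U' g -> Ck_on k U (fun x => g (f x)).
Proof.
move=> oU oU' sU; elim: k f g sU => [|k IH] f g sU.
  by move=> cf cg x Ux; apply: continuous_comp; [exact: cf | exact/cg/sU].
move=> Cf Cg.
apply: (CkS_intro (df := fun x v => 'd g (f x) ('d f x v))) => // [x Ux|v].
  exact: has_diff_comp (CkS_diff Cf Ux) (CkS_diff Cg (sU _ Ux)).
apply: (Ck_lin_app (phi := fun x => 'd g (f x))) => //; last exact: Cf.2.
  by move=> x _ a u w; rewrite linearP.
move=> w; apply: (IH f (fun y => 'd g y w)) => //; first exact: Ck_le.
exact: Cg.2.
Qed.

(** The derivative contains the inverse itself, which is C^k by the induction hypothesis; [Ck_sqrt]
    has the same structure. *)
Lemma CkV V k (U : set V) (f : V -> R^o) : open U ->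
  (forall x, U x -> f x != 0) -> Ck_on k U f -> Ck_on k U
    (fun x => (f x)^-1 : R^o).
Proof.
move=> oU f0; elim: k => [|k IH] Cf.
  by move=> x Ux; apply: continuousV; [exact: f0 | exact: Cf].
apply: (CkS_intro (df := fun x v => (- ((f x)^-1 * (f x)^-1) : R) *: 'd f x v))
  => // [x Ux|v].
  have [df _] := CkS_diff Cf Ux.
  split; first exact: (differentiableV df (f0 _ Ux)).
  by rewrite -invfM -expr2; exact: (diffV df (f0 _ Ux)).
apply: (Ck_scale (f := fun x => - ((f x)^-1 * (f x)^-1) : R^o)) => //;
  last exact: Cf.2.
apply: CkN => //.
by apply: (Ck_scale (f := fun x => (f x)^-1 : R^o)
  (g := fun x => (f x)^-1 : R^o)) => //; apply: IH; exact: Ck_le.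
Qed.

Lemma has_diff_sqrt (y : R^o) : 0 < (y : R) ->
  has_diff (Num.sqrt : R^o -> R^o) y
    (fun v : R^o => (v : R) *: ((2 * Num.sqrt y)^-1 : R^o)).
Proof.
move=> y0; have [ds vs] := is_derive1_sqrt y0.
have h : differentiable (Num.sqrt : R^o -> R^o) y by exact/derivable1_diffP.
split=> //; apply/funext => v.
rewrite -vs (deriveE _ h).
by rewrite -[in LHS](mulr1 v) -[v * 1]/(v *: (1 : R^o)) linearZ.
Qed.

Lemma Ck_sqrt V k (U : set V) (f : V -> R^o) : open U ->
  (forall x, U x -> 0 < (f x : R)) -> Ck_on k U f ->
  Ck_on k U (fun x => Num.sqrt (f x) : R^o).
Proof.
move=> oU f0; elim: k => [|k IH] Cf.
  move=> x Ux; apply: (continuous_comp (f := f) (g := Num.sqrt : R^o -> R^o));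
    first exact: Cf.
  exact: sqrt_continuous.
apply: (CkS_intro (df := fun x v => ((2 * Num.sqrt (f x))^-1 : R) *: 'd f x v))
  => // [x Ux|v].
  apply: has_diff_eq (has_diff_comp (CkS_diff Cf Ux) (has_diff_sqrt (f0 _ Ux)))
    _ => v.
  exact: mulrC.
apply: (Ck_scale (f := fun x => (2 * Num.sqrt (f x))^-1 : R^o)) => //;
  last exact: Cf.2.
apply: CkV => // [x Ux|].
  by rewrite mulf_neq0 // gt_eqF // sqrtr_gt0 f0.
apply: (Ck_scale (f := fun=> 2 : R^o)) => //; first exact: Ck_cst.
by apply: IH; exact: Ck_le.
Qed.

(** * Symmetry of second derivatives *)

Lemma MVT_line V (f : V -> R^o) (df : V -> V -> R^o) (x u : V) (h : R) :
  0 < h ->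
  (forall s : R, 0 <= s <= h -> has_diff f (x + s *: u) (df (x + s *: u))) ->
  exists2 s : R, 0 <= s <= h & f (x + h *: u) - f x = h * df (x + s *: u) u.
Proof.
move=> h0 hf.
have hg (s : R) : 0 <= s <= h -> has_diff (fun s : R^o => f (x + s *: u)) s
    (fun t : R^o => df (x + s *: u) (t *: u)).
  move=> sh.
  have hl : has_diff (fun s : R^o => x + s *: u) s (fun t : R^o => t *: u).
    apply: has_diff_eq (has_diffD (has_diff_cst x _)
      (has_diff_scale (has_diff_id (s : R^o)) (has_diff_cst u _))) _ => t.
    by rewrite add0r scaler0 addr0.
  exact: (has_diff_comp hl (hf _ sh)).
have dg (s : R) : 0 <= s <= h ->
    is_derive (s : R^o) 1 (fun s : R^o => f (x + s *: u)) (df (x + s *: u) u).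
  move=> sh; have [d e] := hg _ sh.
  apply: DeriveDef; first exact/derivable1_diffP.
  by rewrite deriveE // e scale1r.
have [||s sh E] := @MVT R (fun s : R^o => f (x + s *: u))
    (fun s => df (x + s *: u) u) 0 h h0.
- by move=> s /[!in_itv] /= /andP[s0 s1]; apply: dg; rewrite !ltW.
- apply: derivable_within_continuous => s /[!in_itv] /= sh.
  by have [] := dg _ sh.
exists s; first by move: sh => /[!in_itv] /= /andP[s0 s1]; rewrite !ltW.
by move: E; rewrite scale0r addr0 subr0 mulrC.
Qed.

(** Two mean value theorems: along [u] for the increment of [f] by [h *: v], then along [v] for the
    derivative of [f] in the direction [u]. *)
Lemma mixed_difference V (U : set V) (f : V -> R^o) (x u v : V) (h : R) :
  Ck_on 2 U f -> 0 < h ->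
  (forall s t : R, 0 <= s <= h -> 0 <= t <= h -> U (x + s *: u + t *: v)) ->
  exists s t : R, [/\ 0 <= s <= h, 0 <= t <= h &
    f (x + h *: u + h *: v) - f (x + h *: u) - (f (x + h *: v) - f x) =
    h * (h * 'd (fun y => 'd f y u : R^o) (x + s *: u + t *: v) v)].
Proof.
move=> Cf h0 hU.
have hh : 0 <= h <= h by rewrite lexx ltW.
have h00 : 0 <= (0 : R) <= h by rewrite lexx ltW.
pose g y := f (y + h *: v) - f y.
have hU0 s : 0 <= s <= h -> U (x + s *: u).
  by move=> sh; rewrite -[_ + _]addr0 -(scale0r v); exact: hU.
have hg s : 0 <= s <= h -> has_diff g (x + s *: u)
    (fun w => 'd f (x + s *: u + h *: v) w - 'd f (x + s *: u) w).
  move=> sh; apply: has_diffB; last exact: CkS_diff Cf (hU0 _ sh).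
  have hs := has_diffD (has_diff_id (x + s *: u))
    (has_diff_cst (h *: v) (x + s *: u)).
  have := has_diff_comp hs (CkS_diff Cf (hU _ _ sh hh)).
  by move=> H; apply: has_diff_eq H _ => w; rewrite addr0.
have [s sh E] := @MVT_line _ g (fun y w => 'd f (y + h *: v) w - 'd f y w) x u
  h h0 hg.
have [|t th E'] := @MVT_line _ (fun y => 'd f y u : R^o)
  (fun y => 'd (fun y => 'd f y u : R^o) y) (x + s *: u) v h h0.
  by move=> t th; exact: (CkS_diff (k := 0) (Cf.2 u) (hU _ _ sh th)).
by exists s, t; split => //; rewrite -E' -E /g addrAC [x + _ + _]addrAC.
Qed.

Lemma near_parallelogram V (P : set V) (x u v : V) : (\near x, P x) ->
  exists2 h : R, 0 < h &
   forall s t : R, 0 <= s <= h -> 0 <= t <= h -> P (x + s *: u + t *: v).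
Proof.
move=> /nbhs_ballP[e /= e0 he].
have n0 : 0 < `|u| + `|v| + 1 by rewrite ltr_wpDl // addr_ge0.
(* The summand 1 keeps the denominator positive when both vectors vanish, and the factor 1/2 makes
   the final bound strict. *)
exists (e / (`|u| + `|v| + 1) / 2); first by rewrite !divr_gt0.
set h := _ / _ / _ => s t /andP[s0 s1] /andP[t0 t1]; apply: he.
rewrite -ball_normE /= -addrA opprD addNKr normrN.
apply: le_lt_trans (ler_normD _ _) _; rewrite !normrZ !ger0_norm //.
apply: (@le_lt_trans _ _ (h * (`|u| + `|v| + 1))).
  rewrite !mulrDr mulr1 -[leLHS]addr0 !lerD // ?ler_wpM2r //.
  exact: le_trans s1.
by rewrite /h mulrAC divfK ?gt_eqF // ltr_pdivrMr // ltr_pMr // ltr1n.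
Qed.

(** The second difference is symmetric in [u] and [v], so the two mixed derivatives agree at two
    points of an arbitrarily small parallelogram; continuity carries this to [x]. *)
Lemma diff2_sym_real V (U : set V) (f : V -> R^o) (x u v : V) :
  open U -> Ck_on 2 U f -> U x ->
  'd (fun y => 'd f y u : R^o) x v = 'd (fun y => 'd f y v : R^o) x u :> R.
Proof.
move=> oU Cf Ux; apply/eqP; rewrite -subr_eq0 -normr_le0;
  apply/ler_addgt0Pl => e e0.
have e20 : 0 < e / 2 by rewrite divr_gt0.
pose D u v y : R := 'd (fun y => 'd f y u : R^o) y v.
rewrite -/(D u v x) -/(D v u x).
have c u' v' : \forall y \near x, `|D u' v' x - D u' v' y| < e / 2.
  have := (Cf.2 u').2 v' x Ux; rewrite /prop_for /continuous_at =>
    /cvgrPdist_lt.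
  by apply.
have nP : \forall y \near x, [/\ U y, `|D u v x - D u v y| < e / 2 &
    `|D v u x - D v u y| < e / 2].
  by near=> y; split; near: y; [exact: near_open | exact: c | exact: c].
have [h h0 hP] := near_parallelogram u v nP.
have hU s t : 0 <= s <= h -> 0 <= t <= h -> U (x + s *: u + t *: v).
  by move=> sh th; have [] := hP _ _ sh th.
have hU' s t : 0 <= s <= h -> 0 <= t <= h -> U (x + s *: v + t *: u).
  by move=> sh th; rewrite addrAC; exact: hU.
have [s [t [sh th E]]] := mixed_difference Cf h0 hU.
have [s' [t' [sh' th' E']]] := mixed_difference Cf h0 hU'.
have EE : D u v (x + s *: u + t *: v) = D v u (x + t' *: u + s' *: v).
  have hn0 : h != 0 by rewrite gt_eqF.
  apply: (mulfI hn0); apply: (mulfI hn0); move: E E'.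
  rewrite -/(D u v _) -/(D v u _) [x + s' *: v + _]addrAC => <- <-.
  by rewrite [x + h *: v + h *: u]addrAC !opprB addrACA [RHS]addrACA
    [- _ - _]addrC.
have [_ A _] := hP _ _ sh th; have [_ _ B] := hP _ _ th' sh'.
rewrite EE in A; rewrite addr0 (splitr e).
rewrite -(subrK (D v u (x + t' *: u + s' *: v)) (D u v x)) -addrA.
apply: le_trans (ler_normD _ _) _; apply: lerD; first exact: ltW.
by rewrite distrC; exact: ltW.
Unshelve. all: by end_near. Qed.

Lemma diff2_sym V n (U : set V) (f : V -> 'rV[R]_n) (x u v : V) :
  open U -> Ck_on 2 U f -> U x ->
  'd (fun y => 'd f y u) x v = 'd (fun y => 'd f y v) x u.
Proof.
move=> oU Cf Ux; apply/rowP => i.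
have hc y : U y -> has_diff (fun y => f y 0 i : R^o) y (fun w => 'd f y w 0 i).
  by move=> Uy; exact: has_diff_comp (CkS_diff Cf Uy) (has_diff_coord i _).
have h2 w w' : 'd (fun y => 'd f y w) x w' 0 i =
    'd (fun y => 'd (fun y => f y 0 i : R^o) y w : R^o) x w'.
  have /has_diff_near : \near x, 'd f x w 0 i = 'd (fun y => f y 0 i : R^o) x w.
    by apply: filterS (near_open oU Ux) => y /hc [_ ->].
  move=> H; have [_ ->] := H _ (has_diff_comp (CkS_diff (k := 0) (Cf.2 w) Ux)
    (has_diff_coord i _)).
  by [].
by rewrite !h2; exact: (diff2_sym_real u v oU (Ck_coord (k := 2) i oU Cf) Ux).
Qed.
End Smooth.

(** * O'Neill's formula in charts *)

Section LinearFun.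
Context (R : realType) (V W : normedModType R) (f : V -> W).
Hypothesis lf : linear f.

(** Metrics, Christoffel maps and projections are bare functions, known to be linear only at points
    of the domain; these rules take linearity as a hypothesis instead of a bundled structure. *)
Lemma linear_fun0 : f 0 = 0.
Proof. by have := lf (-1) 0 0; rewrite scaler0 addr0 scaleN1r addNr. Qed.

Lemma linear_funD u v : f (u + v) = f u + f v.
Proof. by have := lf 1 u v; rewrite !scale1r. Qed.

Lemma linear_funZ a u : f (a *: u) = a *: f u.
Proof. by have := lf a u 0; rewrite !addr0 linear_fun0 addr0. Qed.

Lemma linear_funN u : f (- u) = - f u.
Proof. by rewrite -scaleN1r linear_funZ scaleN1r. Qed.

Lemma linear_funB u v : f (u - v) = f u - f v.
Proof. by rewrite linear_funD linear_funN. Qed.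
End LinearFun.

(** A Riemannian metric and its Levi-Civita connection seen in one chart: [G x u v] is the covariant
    derivative along [u] of the constant field [v], and [cg_compatible] says that the metric is
    parallel. *)
Record chart_geometry (R : realType) (n : nat) (U : set 'rV[R]_n)
    (g : 'rV[R]_n -> 'rV[R]_n -> 'rV[R]_n -> R)
    (G : 'rV[R]_n -> 'rV[R]_n -> 'rV[R]_n -> 'rV[R]_n) : Prop := ChartGeometry {
  cg_sym : forall x u v, U x -> g x u v = g x v u;
  cg_linear : forall x v, U x -> linear (fun u => g x u v : R^o);
  cg_pos : forall x u, U x -> u != 0 -> 0 < g x u u;
  cg_smooth : forall u v, smooth_on U (fun x => g x u v : R^o);
  cg_linearl : forall x v, U x -> linear (fun u => G x u v);
  cg_linearr : forall x u, U x -> linear (G x u);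
  cg_torsion_free : forall x u v, U x -> G x u v = G x v u;
  cg_christoffel_smooth : forall u v, smooth_on U (fun x => G x u v);
  cg_compatible : forall x u v w, U x ->
    'd (fun x => g x u v : R^o) x w = g x (G x w u) v + g x u (G x w v)
}.

(** O'Neill's sign, evaluated on constant fields: these commute, so the bracket term is absent. *)
Definition chart_curvature (R : realType) (n : nat)
    (G : 'rV[R]_n -> 'rV[R]_n -> 'rV[R]_n -> 'rV[R]_n) (x u v w : 'rV[R]_n) :=
  - ('d (fun y => G y v w) x u + G x u (G x v w)) +
    ('d (fun y => G y u w) x v + G x v (G x u w)).

Section ChartGeometry.
Context (R : realType) (n : nat) (U : set 'rV[R]_n).
Context (g : 'rV[R]_n -> 'rV[R]_n -> 'rV[R]_n -> R).
Context (G : 'rV[R]_n -> 'rV[R]_n -> 'rV[R]_n -> 'rV[R]_n).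
Hypotheses (oU : open U) (cg : chart_geometry U g G).

Lemma cg_linear2 x u : U x -> linear (g x u : 'rV[R]_n -> R^o).
Proof.
move=> Ux a v w; rewrite !(cg_sym cg u) //; exact: (cg_linear cg u Ux).
Qed.

Lemma cgD x u v w : U x -> g x (u + v) w = g x u w + g x v w.
Proof.
by move=> Ux; have := cg_linear cg w Ux 1 u v; rewrite !scale1r.
Qed.

Lemma cg0 x w : U x -> g x 0 w = 0.
Proof. by move=> Ux; have := cgD 0 0 w Ux; rewrite addr0; lra. Qed.

Lemma cgZ x a u w : U x -> g x (a *: u) w = a * g x u w.
Proof. by move=> Ux; have := cg_linear cg w Ux a u 0;
  rewrite addr0 cg0 // addr0. Qed.

Lemma cgN x u w : U x -> g x (- u) w = - g x u w.
Proof. by move=> Ux; rewrite -scaleN1r cgZ // mulN1r. Qed.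

Lemma cgB x u v w : U x -> g x (u - v) w = g x u w - g x v w.
Proof. by move=> Ux; rewrite cgD // cgN. Qed.

Lemma cgDr x u v w : U x -> g x w (u + v) = g x w u + g x w v.
Proof. by move=> Ux; rewrite !(cg_sym cg w) // cgD. Qed.

Lemma cg_nondegenerate x u : U x -> (forall v, g x u v = 0) -> u = 0.
Proof.
move=> Ux h; apply/eqP/negP => /negP u0.
by have := cg_pos cg Ux u0; rewrite h ltxx.
Qed.

Lemma cg_has_diff x u v : U x -> has_diff (fun x => g x u v : R^o) x
  (fun w => g x (G x w u) v + g x u (G x w v)).
Proof.
move=> Ux; apply: has_diff_eq (CkS_diff (cg_smooth cg u v 1) Ux) _ => w.
exact: (cg_compatible cg).
Qed.

Lemma cg_christoffel_diff x u v : U x ->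
  has_diff (fun x => G x u v) x ('d (fun x => G x u v) x).
Proof. exact: (CkS_diff (cg_christoffel_smooth cg u v 1)). Qed.

End ChartGeometry.

(* [DF] is the differential of [F] and [P] the orthogonal projection onto the
   horizontal distribution. *)
Record chart_submersion (R : realType) (n k : nat) (U : set 'rV[R]_n)
    (U' : set 'rV[R]_k) (g : 'rV[R]_n -> 'rV[R]_n -> 'rV[R]_n -> R)
    (h : 'rV[R]_k -> 'rV[R]_k -> 'rV[R]_k -> R) (F : 'rV[R]_n -> 'rV[R]_k)
    (DF : 'rV[R]_n -> 'rV[R]_n -> 'rV[R]_k)
    (P : 'rV[R]_n -> 'rV[R]_n -> 'rV[R]_n) : Prop := ChartSubmersion {
  cs_maps : forall x, U x -> U' (F x);
  cs_diff : forall x, U x -> has_diff F x (DF x);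
  cs_surj : forall x w, U x -> exists u, DF x u = w;
  cs_linear : forall x, U x -> linear (P x);
  cs_diff_proj : forall x u, U x -> DF x (P x u) = DF x u;
  cs_isometry : forall x u v, U x -> h (F x) (DF x u) (DF x v) = g x (P x u) v
}.

(** * The second fundamental form of a submersion in charts *)

Section ONeill.
Context (R : realType) (n k : nat) (U : set 'rV[R]_n) (U' : set 'rV[R]_k).
Context (g : 'rV[R]_n -> 'rV[R]_n -> 'rV[R]_n -> R).
Context (G : 'rV[R]_n -> 'rV[R]_n -> 'rV[R]_n -> 'rV[R]_n).
Context (h : 'rV[R]_k -> 'rV[R]_k -> 'rV[R]_k -> R).
Context (Dl : 'rV[R]_k -> 'rV[R]_k -> 'rV[R]_k -> 'rV[R]_k).
Context (F : 'rV[R]_n -> 'rV[R]_k) (DF : 'rV[R]_n -> 'rV[R]_n -> 'rV[R]_k).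
Context (P : 'rV[R]_n -> 'rV[R]_n -> 'rV[R]_n).
Hypotheses (oU : open U) (oU' : open U').
Hypotheses (cg : chart_geometry U g G) (ch : chart_geometry U' h Dl).
Hypothesis (cs : chart_submersion U U' g h F DF P).

Let maps := cs_maps cs.

(* The derivatives are variables, since unification unfolds nested ['d]:
   [dP x u v] is the derivative of [P^~ v] along [u], [d2F x u v] that of
   [DF^~ v] along [u] and [d3F x u v w] that of [d2F^~ v w] along [u]. *)
Context (dP : 'rV[R]_n -> 'rV[R]_n -> 'rV[R]_n -> 'rV[R]_n).
Context (d2F : 'rV[R]_n -> 'rV[R]_n -> 'rV[R]_n -> 'rV[R]_k).
Context (d3F : 'rV[R]_n -> 'rV[R]_n -> 'rV[R]_n -> 'rV[R]_n -> 'rV[R]_k).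
Hypothesis diffP : forall x v, U x -> has_diff (P^~ v) x (dP x ^~ v).
Hypothesis diff2F : forall x v, U x -> has_diff (DF^~ v) x (d2F x ^~ v).
Hypothesis diff3F : forall x v w, U x ->
  has_diff (fun y => d2F y v w) x (fun u => d3F x u v w).
Hypothesis d2F_sym : forall x u v, U x -> d2F x u v = d2F x v u.
Hypothesis d3F_sym : forall x u v w, U x -> d3F x u v w = d3F x v u w.

Context (B : 'rV[R]_n -> 'rV[R]_n -> 'rV[R]_n -> 'rV[R]_k).
Hypothesis BE : forall x u v,
  B x u v = d2F x u v + Dl (F x) (DF x u) (DF x v) - DF x (G x u v).

Let linear_DF x : U x -> linear (DF x).
Proof. by move=> Ux; exact: has_diff_linearP (cs_diff cs Ux). Qed.

Let B_sym x u v : U x -> B x u v = B x v u.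
Proof.
move=> Ux; rewrite !BE d2F_sym // (cg_torsion_free cg) //.
by rewrite (cg_torsion_free ch) //; exact: maps.
Qed.

(** By [cs_isometry], [P x u] is determined by [DF x u], and [u] and [P x u] have the same image
    under [DF x]. *)
Lemma chart_proj_idem x u : U x -> P x (P x u) = P x u.
Proof.
move=> Ux; apply/eqP; rewrite -subr_eq0; apply/eqP.
apply: (cg_nondegenerate cg Ux) => v; rewrite (cgB cg) //.
by rewrite -!(cs_isometry cs) // (cs_diff_proj cs) // subrr.
Qed.

Lemma chart_proj_sym x u v : U x -> g x (P x u) v = g x u (P x v).
Proof.
move=> Ux; rewrite -(cs_isometry cs) // (cg_sym ch); last exact: maps.
by rewrite (cs_isometry cs) // (cg_sym cg).
Qed.

Let near_U x : U x -> \near x, U x. Proof. exact: near_open. Qed.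

(** Differentiating P P v = P v gives dP (P v) + P (dP v) = dP v; if v is horizontal at [x] the
    outer terms agree, so the derivative of [P] makes v vertical. *)
Let dP_proj x u v : U x -> P x v = v -> P x (dP x u v) = 0.
Proof.
move=> Ux Pv.
have lP : \near x, linear (P x).
  by apply: filterS (near_U Ux) => y Uy; exact: (cs_linear cs).
have H := has_diff_lin_app lP (fun w => diffP w Ux) (diffP v Ux).
have /has_diff_near : \near x, P x (P x v) = P x v.
  by apply: filterS (near_U Ux) => y Uy; exact: chart_proj_idem.
move=> /(_ _ H) H'.
by have := has_diff_unique H' (diffP v Ux) u; rewrite Pv => /(canRL (addKr _));
  rewrite addNr.
Qed.

Let diff_g_app x Y dY Z dZ : U x -> has_diff Y x dY -> has_diff Z x dZ ->
  has_diff (fun y => g y (Y y) (Z y) : R^o) x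
    (fun u => g x (G x u (Y x)) (Z x) + g x (Y x) (G x u (Z x)) +
              g x (dY u) (Z x) + g x (Y x) (dZ u)).
Proof.
move=> Ux; apply: (has_diff_bilin_app (phi := fun y v w => g y v w : R^o)
  (dphi := fun v w u => g x (G x u v) w + g x v (G x u w))).
  apply: filterS (near_U Ux) => y Uy; split=> w;
    [exact: (cg_linear2 cg)|exact: (cg_linear cg)].
by move=> v w; exact: (cg_has_diff cg).
Qed.

Let diff_h_app x Y dY Z dZ : U x -> has_diff Y x dY -> has_diff Z x dZ ->
  has_diff (fun y => h (F y) (Y y) (Z y) : R^o) x
    (fun u => h (F x) (Dl (F x) (DF x u) (Y x)) (Z x) +
              h (F x) (Y x) (Dl (F x) (DF x u) (Z x)) +
              h (F x) (dY u) (Z x) + h (F x) (Y x) (dZ u)).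
Proof.
move=> Ux; apply: (has_diff_bilin_app (phi := fun y v w => h (F y) v w : R^o)
  (dphi := fun v w u => h (F x) (Dl (F x) (DF x u) v) w + h (F x) v
    (Dl (F x) (DF x u) w))).
  apply: filterS (near_U Ux) => y Uy; have U'y := maps Uy.
  by split=> w; [exact: (cg_linear2 ch)|exact: (cg_linear ch)].
move=> v w; exact: (has_diff_comp (cs_diff cs Ux)
  (cg_has_diff ch v w (maps Ux))).
Qed.

(** The derivative of h(DF v, DF w) = g(P v, w) along [u]. Since both metrics are parallel, the
    Christoffel terms complete the second derivatives of [F] to [B], and the terms g(P v, G u w)
    cancel. *)
Let isometry_diff x u v w : U x ->
  h (F x) (B x u v) (DF x w) + h (F x) (DF x v) (B x u w) =
  g x (G x u (P x v)) w - g x (G x u v) (P x w) + g x (dP x u v) w.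
Proof.
move=> Ux; have U'x := maps Ux.
have H := diff_h_app Ux (diff2F v Ux) (diff2F w Ux).
have /has_diff_near : \near x, (h (F x) (DF x v) (DF x w) : R^o) = g x
  (P x v) w.
  by apply: filterS (near_U Ux) => y Uy; exact: (cs_isometry cs).
move=> /(_ _ H) H'.
have := has_diff_unique H' (diff_g_app Ux (diffP v Ux) (has_diff_cst w x)) u =>
  /=.
rewrite (cg_sym cg _ 0) // (cg0 cg) // addr0.
rewrite !BE !(cgB ch) // !(cgD ch) // !(cg_sym ch (DF x v) _) // !(cgB ch) //
  !(cgD ch) //.
rewrite !(cs_isometry cs) //.
rewrite !(chart_proj_sym (G _ _ _)) //.
rewrite (cg_sym cg (P x v)) // => E; lra.
Qed.

Let g_vertical x a xi : U x -> P x a = 0 -> g x a (P x xi) = 0.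
Proof. by move=> Ux Pa; rewrite -chart_proj_sym // Pa (cg0 cg). Qed.

(** For horizontal [v] and [w] the right side of [isometry_diff] reduces to g(dP u v, w), which
    pairs a vertical vector with a horizontal one. *)
Let B_skew x u v w : U x -> P x v = v -> P x w = w ->
  h (F x) (B x u v) (DF x w) = - h (F x) (B x u w) (DF x v).
Proof.
move=> Ux Pv Pw; have := isometry_diff u v w Ux; rewrite Pv Pw subrr add0r.
have -> : g x (dP x u v) w = 0.
  by rewrite -Pw -chart_proj_sym // dP_proj // (cg0 cg).
by rewrite (cg_sym ch (DF x v)); [lra | exact: maps].
Qed.

Let B_horizontal x u v : U x -> P x u = u -> P x v = v -> B x u v = 0.
Proof.
move=> Ux Pu Pv; apply: (cg_nondegenerate ch (maps Ux)) => w.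
have [z <-] := cs_surj cs w Ux; rewrite -(cs_diff_proj cs) //.
have Pw := chart_proj_idem z Ux; set w' := P x z in Pw *.
(* The trilinear form h(B a b, DF c) is symmetric in its first two arguments and skew in its last
   two, so each cyclic rotation changes its sign; after three rotations it equals its own
   negative. *)
have T a b c : P x a = a -> P x b = b -> P x c = c ->
    h (F x) (B x a b) (DF x c) = - h (F x) (B x c a) (DF x b).
  by move=> Pa Pb Pc; rewrite B_skew // B_sym.
have := T _ _ _ Pu Pv Pw; rewrite (T _ _ _ Pw Pu Pv) (T _ _ _ Pv Pw Pu); lra.
Qed.

Let linear_B x u : U x -> linear (B x u).
Proof.
move=> Ux a v w; rewrite !BE !(d2F_sym u) //.
rewrite (has_diff_linearP (diff2F u Ux)) !(linear_DF Ux).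
rewrite (cg_linearr ch _ (maps Ux)) (cg_linearr cg _ Ux) (linear_DF Ux).
by apply/rowP => i; rewrite !mxE; ring.
Qed.

Let B_vertical x v xi : U x -> P x v = v -> B x v (xi - P x xi) = B x v xi.
Proof.
move=> Ux Pv; have := linear_B v Ux (-1) (P x xi) xi; rewrite !scaleN1r.
by rewrite (B_horizontal Ux Pv (chart_proj_idem xi Ux)) oppr0 add0r addrC.
Qed.

(* The covariant derivative along [u] of the horizontal field [P v]. *)
Let S x u v := dP x u v + G x u v.

Let h_B_vertical x w a z : U x -> P x a = 0 -> P x z = z ->
  h (F x) (B x w a) (DF x z) = g x a (S x w z).
Proof.
move=> Ux Pa Pz; have := isometry_diff w z a Ux.
have -> : DF x a = 0 by rewrite -(cs_diff_proj cs) // Pa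
  (linear_fun0 (linear_DF Ux)).
rewrite Pa Pz (cg_sym ch (DF x z)); last exact: maps.
rewrite !(cg_sym ch _ 0) ?(cg_sym cg _ 0) ?(cg0 cg) ?(cg0 ch) //;
  try exact: maps.
by rewrite /S (cgDr cg) // !(cg_sym cg a) //; lra.
Qed.

(** Skewness of the O'Neill tensor on horizontal vectors: the symmetry of [B] and [B_skew], read
    through [h_B_vertical]. *)
Let S_skew x a v w : U x -> P x a = 0 -> P x v = v -> P x w = w ->
  g x a (S x v w) = - g x a (S x w v).
Proof.
move=> Ux Pa Pv Pw; rewrite -!h_B_vertical // !(B_sym _ a) // -B_skew //.
Qed.

(** The plain derivative of [B] with constant arguments, term by term in [BE]; the Christoffel
    corrections of the covariant derivative enter in [ricci]. *)
Let dB x u v w := d3F x u v w +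
  ('d (fun y => Dl y (DF x v) (DF x w)) (F x) (DF x u) +
   Dl (F x) (d2F x u v) (DF x w) + Dl (F x) (DF x v) (d2F x u w)) -
  (d2F x u (G x v w) + DF x ('d (fun y => G y v w) x u)).

Let diffB x v w : U x -> has_diff (fun y => B y v w) x (fun u => dB x u v w).
Proof.
move=> Ux; have U'x := maps Ux.
have H1 : has_diff (fun y => Dl (F y) (DF y v) (DF y w)) x (fun u =>
    'd (fun y => Dl y (DF x v) (DF x w)) (F x) (DF x u) +
    Dl (F x) (d2F x u v) (DF x w) + Dl (F x) (DF x v) (d2F x u w)).
  apply: (has_diff_bilin_app (phi := fun y a b => Dl (F y) a b)
    (dphi := fun a b u => 'd (fun y => Dl y a b) (F x) (DF x u))).
  - apply: filterS (near_U Ux) => y Uy; have U'y := maps Uy.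
    by split=> a; [exact: (cg_linearr ch) | exact: (cg_linearl ch)].
  - move=> a b.
    exact: (has_diff_comp (cs_diff cs Ux) (cg_christoffel_diff ch a b U'x)).
  - exact: diff2F.
  - exact: diff2F.
have H2 : has_diff (fun y => DF y (G y v w)) x (fun u =>
    d2F x u (G x v w) + DF x ('d (fun y => G y v w) x u)).
  apply: (has_diff_lin_app (phi := DF) (dphi := fun a u => d2F x u a)).
  - by apply: filterS (near_U Ux) => y Uy; exact: linear_DF.
  - by move=> a; exact: diff2F.
  - exact: (cg_christoffel_diff cg).
have -> : (fun y => B y v w) =
    (fun y => d2F y v w + Dl (F y) (DF y v) (DF y w) - DF y (G y v w)).
  by apply/funext => y; rewrite BE.
exact: has_diffB (has_diffD (diff3F v w Ux) H1) H2.
Qed.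

(** The right side is (nabla_u B)(v, w) - (nabla_v B)(u, w) written out: the corrections B(G u v, w)
    cancel because [G] and [B] are symmetric. On the left the third derivatives of [F] have
    cancelled by [d3F_sym]. *)
Let ricci x u v w : U x ->
  DF x (chart_curvature G x u v w) -
    chart_curvature Dl (F x) (DF x u) (DF x v) (DF x w) =
  dB x u v w - dB x v u w - Dl (F x) (DF x v) (B x u w) +
    Dl (F x) (DF x u) (B x v w) + B x u (G x v w) - B x v (G x u w).
Proof.
move=> Ux; have U'x := maps Ux; have lD := linear_DF Ux.
rewrite /chart_curvature /dB (d3F_sym v u) // !BE.
rewrite !(linear_funD lD, linear_funN lD).
have lr a := cg_linearr ch a U'x.
rewrite !(linear_funB (lr _), linear_funD (lr _)).
rewrite (d2F_sym v u) // (cg_torsion_free ch (d2F x u v)) //.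
by apply/rowP => i; rewrite !mxE; ring.
Qed.

Let dB_horizontal x u v w : U x -> P x v = v -> P x w = w ->
  dB x u v w = - B x (dP x u v) w - B x v (dP x u w).
Proof.
move=> Ux Pv Pw.
have H : has_diff (fun y => B y (P y v) (P y w)) x
    (fun u => dB x u (P x v) (P x w) + B x (dP x u v) (P x w) + B x (P x v)
      (dP x u w)).
  apply: (has_diff_bilin_app (phi := B) (dphi := fun a b u => dB x u a b)).
  - apply: filterS (near_U Ux) => y Uy; split=> a; first exact: linear_B.
    by move=> c b d; rewrite !(B_sym _ a) //; exact: linear_B.
  - by move=> a b; exact: diffB.
  - exact: diffP.
  - exact: diffP.
have /has_diff_near : \near x, 0 = B x (P x v) (P x w).
  by apply: filterS (near_U Ux) => y Uy;
    rewrite B_horizontal // chart_proj_idem.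
move=> /(_ _ (has_diff_cst 0 x)) H'.
have := has_diff_unique H H' u; rewrite Pv Pw -addrA => /eqP.
by rewrite addr_eq0 opprD => /eqP.
Qed.

Let QE x xi : U x -> P x (xi - P x xi) = 0.
Proof.
by move=> Ux; rewrite (linear_funB (cs_linear cs Ux)) chart_proj_idem // subrr.
Qed.

Let g_Q x a xi : U x -> P x a = 0 -> g x a (xi - P x xi) = g x a xi.
Proof.
move=> Ux Pa; rewrite (linear_funB (cg_linear2 cg a Ux)).
by rewrite g_vertical // subr0.
Qed.

Let vert x xi := xi - P x xi.

Let linear_vert x : U x -> linear (vert x).
Proof.
move=> Ux a u v; rewrite /vert (cs_linear cs Ux).
by apply/rowP => i; rewrite !mxE; ring.
Qed.

Lemma chart_oneill x u v : U x -> P x u = u -> P x v = v ->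
  let xi := dP x u v - dP x v u in
  g x (chart_curvature G x u v v) u -
    h (F x) (chart_curvature Dl (F x) (DF x u) (DF x v) (DF x v)) (DF x u) =
  3 / 4 * g x (xi - P x xi) (xi - P x xi).
Proof.
move=> Ux Pu Pv xi; have U'x := maps Ux.
pose w := vert x (dP x u v - dP x v u); rewrite -/(vert x xi) -/w.
have -> : g x (chart_curvature G x u v v) u =
    h (F x) (DF x (chart_curvature G x u v v)) (DF x u).
  by rewrite (cs_isometry cs) // chart_proj_sym // Pu.
rewrite -(cgB ch) // ricci // !dB_horizontal // (B_horizontal Ux Pu Pv)
  (B_horizontal Ux Pv Pv).
rewrite !(linear_fun0 (cg_linearr ch _ U'x)) subr0 addr0.
(* Each Christoffel term absorbs one derivative of [P] into [S]; the derivatives left over form the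
   bracket. [B_vertical] then allows only the vertical parts to be kept. *)
rewrite [X in h (F x) X _](_ : _ = B x u (vert x (S x v v)) -
    B x v (vert x (S x u v)) - B x v (vert x (dP x u v - dP x v u)));
      last first.
  rewrite /vert !B_vertical // (linear_funB (linear_B v Ux)) /S.
  rewrite !(linear_funD (linear_B _ Ux)) !(B_sym _ v) //.
  by apply/rowP => i; rewrite !mxE; ring.
rewrite -/w !(cgB ch) // !h_B_vertical //; try exact: QE.
have Sw : w = vert x (S x u v) - vert x (S x v u).
  rewrite -(linear_funB (linear_vert Ux)) /S (cg_torsion_free cg) //.
  by congr (vert x _); apply/rowP => i; rewrite !mxE; ring.
have Q0 a : P x (vert x a) = 0 by exact: QE.
have skew a : g x (vert x a) (S x v u) = - g x (vert x a) (S x u v).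
  by rewrite S_skew.
have skew0 : g x (vert x (S x v v)) (S x u u) = 0.
  by have := S_skew Ux (Q0 (S x v v)) Pu Pu; lra.
rewrite skew0 !skew.
(* By skewness [w] is twice the vertical part of [S x u v]. *)
have gw a : g x (vert x a) w = 2 * g x (vert x a) (S x u v).
  rewrite Sw (linear_funB (cg_linear2 cg _ Ux)) /vert !g_Q // ?QE //.
  by rewrite -/(vert x a) skew; lra.
have gww := gw (dP x u v - dP x v u); rewrite -/w in gww.
have e1 : g x (vert x (S x u v)) w = g x w (S x u v).
  by rewrite (cg_sym cg) // /vert g_Q // QE.
(* The curvature difference is now g(vert S, S) + g(w, S) with S = [S x u v]; the two instances of
   [gw] turn the summands into 1/4 and 1/2 of g(w, w). *)
have := gw (S x u v); rewrite e1 -/w gww; lra.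
Qed.
End ONeill.

(** * Manifolds in charts *)

Section Manifold.
Context (R : realType) (n : nat) (M : manifold R n).
Implicit Types (p q r y : M) (U : set M) (W : normedModType R).

Let open_dom p : open (cdom p).
Proof. exact: cdom_open. Qed.

Let open_img p : open (chart p @` cdom p).
Proof. exact: cimage_open. Qed.

Lemma chart_image_cinv p U x : (chart p @` (cdom p `&` U)) x ->
  [/\ cdom p (cinv p x), U (cinv p x) & chart p (cinv p x) = x].
Proof. by move=> [y [py Uy] <-]; rewrite chartK. Qed.

Lemma chart_image_open p U : open U -> open (chart p @` (cdom p `&` U)).
Proof.
move=> oU; rewrite openE => x ix; have [px Ux cx] := chart_image_cinv ix.
have ix' : (chart p @` cdom p) x by exists (cinv p x).
have nU : \near x, U (cinv p x).
  exact: (cinv_continuous ix' (open_nbhs_nbhs (conj oU Ux))).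
have nI := near_open (@open_img p) ix'.
rewrite /interior /=; near=> z.
have [y py zy] : (chart p @` cdom p) z.
  by near: z; exact: nI.
by exists y => //; split => //; rewrite -(chartK py) zy; near: z.
Unshelve. all: by end_near. Qed.

Lemma near_chart p U y : open U -> cdom p y -> U y ->
  \forall x \near chart p y, (chart p @` (cdom p `&` U)) x.
Proof.
move=> oU py Uy; apply: near_open; first exact: chart_image_open.
by exists y.
Qed.

(** The Jacobian at [y] of the change of coordinates from [chart p] to [chart q]. A tangent vector
    at [y] is stored in [chart y], so [transd y p y] yields its components in [chart p] and
    [transd p y y] goes back. *)
Definition transd p q y : 'rV[R]_n -> 'rV[R]_n :=
  'd (chart q \o cinv p) (chart p y).

Lemma linear_transd p q y : linear (transd p q y).
Proof. by move=> a u v; rewrite /transd linearP. Qed.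

Lemma has_diff_transd p q y : cdom p y -> cdom q y ->
  has_diff (chart q \o cinv p) (chart p y) (transd p q y).
Proof.
by move=> py qy; apply: (CkS_diff (transition_smooth p q 1)); exists y.
Qed.

Lemma has_diff_change_chart W (f : M -> W) p q y df : cdom p y -> cdom q y ->
  has_diff (f \o cinv q) (chart q y) df ->
  has_diff (f \o cinv p) (chart p y) (fun v => df (transd p q y v)).
Proof.
move=> py qy hf.
have E : \forall x \near chart p y,
    f (cinv q (chart q (cinv p x))) = f (cinv p x).
  apply: filterS (near_chart (@open_dom q) py qy) => x
    /chart_image_cinv[_ qx _].
  by rewrite chartK.
apply: has_diff_near E _.
apply: (has_diff_comp (has_diff_transd py qy) (g := f \o cinv q)).
by rewrite /= chartK.
Qed.

Lemma transd_comp p q r y v : cdom p y -> cdom q y -> cdom r y ->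
  transd q r y (transd p q y v) = transd p r y v.
Proof.
move=> py qy ry.
have := has_diff_change_chart py qy (has_diff_transd qy ry).
by move=> /has_diff_unique/(_ (has_diff_transd py ry) v).
Qed.

Lemma transd_id p y v : cdom p y -> transd p p y v = v.
Proof.
move=> py; apply: (has_diff_unique (has_diff_transd py py)).
apply: has_diff_near (has_diff_id _).
apply: filterS (near_chart (@open_dom p) py py) => x /chart_image_cinv[_ _].
by move=> /= ->.
Qed.

Definition comp_field p (X : M -> 'rV[R]_n) y := tder y (X y) (chart p).

Lemma comp_fieldE p X y : comp_field p X y = transd y p y (X y).
Proof. by []. Qed.

(* The vector field on [cdom p] with components [Y] in the chart at [p]. *)
Definition chart_field p (Y : 'rV[R]_n -> 'rV[R]_n) y :=
  transd p y y (Y (chart p y)).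

Lemma coord_fieldE p u y : coord_field p u y = transd p y y u.
Proof. by []. Qed.

Lemma coord_field_id p u : coord_field p u p = u.
Proof. by rewrite coord_fieldE transd_id //; exact: cdom_self. Qed.

Lemma linear_coord_field p y : linear (fun u => coord_field p u y).
Proof. exact: linear_transd. Qed.

Lemma comp_coord_field p u y : cdom p y -> transd y p y (coord_field p u y) = u.
Proof.
by move=> py; rewrite coord_fieldE transd_comp ?transd_id //; exact: cdom_self.
Qed.

Lemma coord_field_comp p X y : cdom p y -> coord_field p (comp_field p X y) y =
  X y.
Proof.
move=> py; rewrite coord_fieldE comp_fieldE transd_comp ?transd_id //;
exact: cdom_self.
Qed.

Lemma coord_field_inj p u v y : cdom p y ->
  coord_field p u y = coord_field p v y -> u = v.
Proof. by move=> py E; rewrite -(comp_coord_field u py) E comp_coord_field. Qed.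

Lemma fsmooth_ext W U (f g : M -> W) : open U -> (forall y, U y -> f y = g y) ->
  fsmooth U f -> fsmooth U g.
Proof.
move=> oU fg sf q k; apply: Ck_ext (sf q k); first exact: chart_image_open.
by move=> x /chart_image_cinv[_ Ux _] /=; exact: fg.
Qed.

Lemma fsmooth_chart W U p (f : M -> W) : open U -> U `<=` cdom p ->
  smooth_on (chart p @` U) (f \o cinv p) -> fsmooth U f.
Proof.
move=> oU Up sf q k.
have UI : chart p @` U = chart p @` (cdom p `&` U).
  by congr (_ @` _); rewrite setIidr.
have oqU := @chart_image_open q _ oU.
apply: (Ck_ext (f := fun x => (f \o cinv p) ((chart p \o cinv q) x))) => //.
  by move=> x /chart_image_cinv[_ Ux _] /=; rewrite chartK //; exact: Up.
apply: (Ck_comp (U' := chart p @` U)) => //.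
- by rewrite UI; exact: chart_image_open.
- by move=> x /chart_image_cinv[_ Ux _] /=; exists (cinv q x).
- apply: Ck_subset (transition_smooth q p k) => x [y [qy Uy] <-].
  by exists y => //; split => //; exact: Up.
Qed.

Lemma fsmooth_diff W U (f : M -> W) y q :
  open U -> fsmooth U f -> U y -> cdom q y ->
  has_diff (f \o cinv q) (chart q y) ('d (f \o cinv q) (chart q y)).
Proof. by move=> oU sf Uy qy; apply: (CkS_diff (sf q 1)); exists y. Qed.

Lemma tder_coord_field W U (f : M -> W) p u y : open U -> fsmooth U f -> U y ->
  cdom p y -> tder y (coord_field p u y) f = 'd (f \o cinv p) (chart p y) u.
Proof.
move=> oU sf Uy py; rewrite /tder coord_fieldE.
have := has_diff_change_chart py (cdom_self y)
  (fsmooth_diff oU sf Uy (cdom_self y)).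
by move=> /has_diff_unique/(_ (fsmooth_diff oU sf Uy py) u).
Qed.

Lemma vsmooth_chart_field U p Y : open U -> U `<=` cdom p ->
  smooth_on (chart p @` U) Y -> vsmooth U (chart_field p Y).
Proof.
move=> oU Up sY q.
have oUq : open (U `&` cdom q) by apply: openI => //; exact: open_dom.
have UI : chart p @` (U `&` cdom q) = chart p @` (cdom p `&` (U `&` cdom q)).
  by congr (_ @` _); rewrite setIA [cdom p `&` U]setIidr.
have oi : open (chart p @` (U `&` cdom q)) by rewrite UI;
  exact: chart_image_open.
apply: (fsmooth_ext (f := fun y => transd p q y (Y (chart p y)))) => //.
  move=> y [/Up py qy]; rewrite -/(comp_field q _ y) comp_fieldE transd_comp //.
  exact: cdom_self.
apply: (fsmooth_chart (p := p)) => // [z [/Up]//|k].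
apply: (Ck_ext (f := fun x => 'd (chart q \o cinv p) x (Y x))) => //.
  by move=> x; rewrite UI => /chart_image_cinv[px _ cx] /=; rewrite /transd cx.
apply: (Ck_lin_app (phi := fun x => 'd (chart q \o cinv p) x)) => //.
- by move=> x _ a u v; rewrite linearP.
- move=> v; apply: Ck_subset ((transition_smooth p q k.+1).2 v) => x
  [y [Uy qy] <-].
  by exists y => //; split => //; exact: Up.
- by apply: Ck_subset (sY k) => x [y [Uy _] <-]; exists y.
Qed.

Lemma vsmooth_coord_field p u : vsmooth (cdom p) (coord_field p u).
Proof.
apply: (vsmooth_chart_field (Y := fun=> u) (@open_dom p)) => // k.
by apply: Ck_cst; exact: open_img.
Qed.

Lemma vsmooth_subset U U' X : U' `<=` U -> vsmooth U X -> vsmooth U' X.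
Proof.
move=> sU sX q r k; apply: Ck_subset (sX q r k) => x [y [ry [Uy qy]] <-].
by exists y => //; do !split => //; exact: sU.
Qed.

Lemma vsmooth_ext U X Y : open U -> (forall y, U y -> X y = Y y) ->
  vsmooth U X -> vsmooth U Y.
Proof.
move=> oU XY sX q; apply: fsmooth_ext (sX q).
  by apply: openI => //; exact: open_dom.
by move=> y [Uy _]; rewrite XY.
Qed.

Lemma vsmooth_comp_field U p X : vsmooth U X ->
  smooth_on (chart p @` (cdom p `&` U)) (comp_field p X \o cinv p).
Proof.
move=> sX k; apply: Ck_subset (sX p p k) => x [y [py Uy] <-].
by exists y.
Qed.

Lemma lieE X Y p : lie X Y p =
  'd (comp_field p Y \o cinv p) (chart p p) (X p) -
  'd (comp_field p X \o cinv p) (chart p p) (Y p).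
Proof. by []. Qed.

(** The bracket at [y] is computed in [chart y], where coordinate fields of [chart p] have the
    derivatives of the transition map as components; it vanishes because second derivatives
    commute. *)
Lemma lie_coord_field p u v y : cdom p y ->
  lie (coord_field p u) (coord_field p v) y = 0.
Proof.
move=> py; have oU : open (cdom p `&` cdom y) by apply: openI; exact: open_dom.
have yU : (cdom p `&` cdom y) y by split=> //; exact: cdom_self.
have d2 w w' : tder y (coord_field p w y) (comp_field y (coord_field p w')) =
    'd (fun x => 'd (chart y \o cinv p) x w') (chart p y) w.
  have sw := vsmooth_coord_field p w' y.
  rewrite (tder_coord_field w oU sw yU py).
  apply: diff_near; first by have [] := fsmooth_diff oU sw yU py.
  apply: filterS (near_chart oU py yU) => x /chart_image_cinv[px [_ yx] cx] /=.
  transitivity (transd p y (cinv p x) w'); last by rewrite /transd cx.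
  exact: (transd_comp w' px (cdom_self (cinv p x)) yx).
rewrite /lie !d2; apply/eqP; rewrite subr_eq0; apply/eqP.
have H := transition_smooth p y 2.
apply: (diff2_sym v u _ H); last by exists y => //; split => //;
  exact: cdom_self.
exact: (@chart_image_open p _ (@open_dom y)).
Qed.
End Manifold.

(** * Christoffel symbols and curvature *)

Section Geometry.
Context (R : realType) (n : nat) (M : manifold R n).
Context (g : M -> 'rV[R]_n -> 'rV[R]_n -> R).
Context (D : M -> 'rV[R]_n -> (M -> 'rV[R]_n) -> 'rV[R]_n).
Implicit Types (p q r y : M) (U : set M).

Definition chart_metric p x u v :=
  g (cinv p x) (coord_field p u (cinv p x)) (coord_field p v (cinv p x)).

Definition christoffel p x u v :=
  comp_field p (fun q => D q (coord_field p u q) (coord_field p v)) (cinv p x).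

Hypotheses (hg : riemannian_metric g) (hD : levi_civita g D).

Lemma riemannian_sym q u v : g q u v = g q v u. Proof. by case: hg. Qed.

Lemma riemannian_linear q v : linear (fun u => g q u v : R^o).
Proof. by move=> a u w; case: hg => _ h _ _; exact: h. Qed.

Lemma riemannian_linearr q u : linear (g q u : _ -> R^o).
Proof. by move=> a v w; rewrite !(riemannian_sym q u) (riemannian_linear q u).
Qed.

Let open_dom p : open (cdom p).
Proof. exact: cdom_open. Qed.

Let open_img p : open (chart p @` cdom p).
Proof. exact: cimage_open. Qed.

Let smooth_coord p u : vsmooth (cdom p) (coord_field p u).
Proof. exact: vsmooth_coord_field. Qed.

Let D_linear p q u : cdom p q -> linear (fun v => D q v (coord_field p u)).
Proof.
move=> pq a v w; exact: (lc_linear hD a v w (@open_dom p) (smooth_coord p u)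
  pq).
Qed.

Let D_smooth p u v : vsmooth (cdom p)
  (fun q => D q (coord_field p u q) (coord_field p v)).
Proof. exact: (lc_smooth hD (@open_dom p)). Qed.

Let coord_christoffel p u v q : cdom p q ->
  coord_field p (christoffel p (chart p q) u v) q = D q (coord_field p u q)
    (coord_field p v).
Proof.
move=> pq; rewrite /christoffel chartK //.
exact: (coord_field_comp (fun q => D q (coord_field p u q) (coord_field p v))
  pq).
Qed.

Lemma tder_cst q v (W : normedModType R) (a : W) : tder q v (fun=> a) = 0.
Proof.
rewrite /tder; have [_ E] := has_diff_cst a (chart q q).
exact: (congr1 (@^~ v) E).
Qed.

Lemma fsmooth_cst U (W : normedModType R) (a : W) :
  open U -> fsmooth U (fun=> a).
Proof. by move=> oU q k; apply: Ck_cst; exact: chart_image_open. Qed.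

Lemma D_scale U a Y q v : open U -> vsmooth U Y -> U q ->
  D q v (fun q => a *: Y q) = a *: D q v Y.
Proof.
move=> oU sY Uq.
have := lc_leibniz hD v oU (fsmooth_cst (a : R^o) oU) sY Uq.
by rewrite tder_cst scale0r add0r.
Qed.

Let D_linearr p q v : cdom p q -> linear (fun u => D q v (coord_field p u)).
Proof.
move=> pq a u w.
have sa : vsmooth (cdom p) (fun q => a *: coord_field p u q).
  apply: (vsmooth_ext (X := coord_field p (a *: u))) => //.
  by move=> y _; rewrite (linear_funZ (linear_coord_field p y)).
rewrite -(D_scale a v (@open_dom p) (smooth_coord p u) pq).
rewrite -(lc_add hD v (@open_dom p) sa (smooth_coord p w) pq).
congr (D q v _); apply/funext => y; exact: linear_coord_field.
Qed.

Lemma chart_geometryP p :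
  chart_geometry (chart p @` cdom p) (chart_metric p) (christoffel p).
Proof.
have lc y := linear_coord_field p y.
split.
- by move=> x u v _; rewrite /chart_metric riemannian_sym.
- by move=> x v _ a u w; rewrite /chart_metric lc (riemannian_linear _ _).
- move=> x u [q pq <-] u0; rewrite /chart_metric chartK //.
  case: hg => _ _ pos _; apply: pos; apply: contra u0 => /eqP E.
  by apply/eqP/(coord_field_inj pq); rewrite E (linear_fun0 (lc q)).
- move=> u v; case: hg => _ _ _ /(_ _ _ _ (@open_dom p) (smooth_coord p u)
  (smooth_coord p v)).
  by move=> H k; have := H p k; rewrite setIid.
- move=> x v [q pq <-] a u w; rewrite /christoffel chartK // !comp_fieldE.
  by rewrite lc (D_linear v pq) linear_transd.
- move=> x u [q pq <-] a v w; rewrite /christoffel chartK // !comp_fieldE.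
  by rewrite (D_linearr _ pq) linear_transd.
- move=> x u v [q pq <-]; rewrite /christoffel chartK // !comp_fieldE.
  congr (transd q p q _); apply/eqP; rewrite -subr_eq0.
  rewrite (lc_torsion_free hD (@open_dom p) (smooth_coord p u)
    (smooth_coord p v) pq).
  by rewrite lie_coord_field.
- by move=> u v k; have := vsmooth_comp_field p (D_smooth p u v) k;
  rewrite setIid.
- move=> x u v w [q pq <-].
  have sg : fsmooth (cdom p) (fun q => g q (coord_field p u q)
    (coord_field p v q) : R^o).
    case: hg => _ _ _; apply => //; exact: smooth_coord.
  transitivity (tder q (coord_field p w q)
      (fun q => g q (coord_field p u q) (coord_field p v q) : R^o)).
    by rewrite (tder_coord_field w (@open_dom p) sg pq pq).
  rewrite (lc_metric hD _ (@open_dom p) (smooth_coord p u) (smooth_coord p v)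
    pq).
  rewrite -(coord_christoffel w u pq) -(coord_christoffel w v pq).
  by rewrite /chart_metric chartK.
Qed.

Lemma vsmooth_sum U (I : Type) (s : seq I) (Y : I -> M -> 'rV[R]_n) : open U ->
  (forall i, vsmooth U (Y i)) -> vsmooth U (fun q => \sum_(i <- s) Y i q).
Proof.
move=> oU sY q; have oUq : open (U `&` cdom q) by exact: openI.
apply: (fsmooth_ext (f := fun p => \sum_(i <- s) tder p (Y i p) (chart q))) =>
  //.
  by move=> y _; rewrite /tder linear_sum.
move=> r k.
apply: (@Ck_sum _ _ _ k _ _ s (fun i x => tder (cinv r x) (Y i (cinv r x))
  (chart q))).
  exact: chart_image_open.
by move=> i; exact: sY.
Qed.

Lemma vsmooth_scale U (f : M -> R^o) (Y : M -> 'rV[R]_n) : open U ->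
  fsmooth U f -> vsmooth U Y -> vsmooth U (fun q => (f q : R) *: Y q).
Proof.
move=> oU sf sY q; have oUq : open (U `&` cdom q) by exact: openI.
apply: (fsmooth_ext (f := fun p => (f p : R) *: tder p (Y p) (chart q))) => //.
  by move=> y _; rewrite /tder linearZ.
move=> r k.
apply: (Ck_scale (f := f \o cinv r)
  (g := fun x => tder (cinv r x) (Y (cinv r x)) (chart q))).
- exact: chart_image_open.
- by apply: Ck_subset (sf r k) => x [y [ry [Uy _]] <-]; exists y.
- exact: sY.
Qed.

Lemma D_sum U (I : Type) (s : seq I) (Y : I -> M -> 'rV[R]_n) q v : open U ->
  (forall i, vsmooth U (Y i)) -> U q ->
  D q v (fun q => \sum_(i <- s) Y i q) = \sum_(i <- s) D q v (Y i).
Proof.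
move=> oU sY Uq; elim: s => [|i s IH].
  rewrite big_nil.
  (* The zero field is 0 times a coordinate field, so [D_scale] also settles the empty sum. *)
  have := D_scale 0 v (@open_dom q) (smooth_coord q 0) (cdom_self q).
  rewrite scale0r => E; rewrite -[RHS]E; congr (D q v _).
  by apply/funext => y; rewrite big_nil scale0r.
rewrite big_cons -IH -(lc_add hD v oU (sY i) (vsmooth_sum s oU sY) Uq).
by congr (D q v _); apply/funext => y; rewrite big_cons.
Qed.

(** The classical coordinate formula, from the Leibniz rule applied to the expansion of the field in
    coordinate fields with the components of [Y] as coefficients. *)
Lemma D_chart_field p Y v : smooth_on (chart p @` cdom p) Y ->
  D p v (chart_field p Y) =
  'd Y (chart p p) v + christoffel p (chart p p) v (Y (chart p p)).
Proof.
move=> sY; have pp := cdom_self p.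
have ip : (chart p @` cdom p) (chart p p) by exists p.
pose f i q : R^o := Y (chart p q) 0 i.
have E : chart_field p Y = fun q => \sum_i (f i q : R) *: coord_field p
  (delta_mx 0 i) q.
  apply/funext => q; exact: (linear_rVE _ (linear_coord_field p q)).
have sf i : fsmooth (cdom p) (f i).
  apply: (fsmooth_chart (p := p)) => // k.
  apply: (Ck_ext (f := fun x => Y x 0 i : R^o)) => //.
    by move=> x [y py <-]; rewrite /f /= chartK.
  exact: Ck_coord.
have sfY i : vsmooth (cdom p) (fun q => (f i q : R) *: coord_field p
  (delta_mx 0 i) q).
  exact: (vsmooth_scale (@open_dom p) (sf i) (smooth_coord p _)).
rewrite E (D_sum _ _ (@open_dom p) sfY pp).
have tf i : tder p v (f i) = 'd Y (chart p p) v 0 i.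
  have H := has_diff_comp (CkS_diff (sY 1) ip) (has_diff_coord i _).
  have nE : \forall x \near chart p p, (Y x 0 i : R^o) = (f i \o cinv p) x.
    apply: filterS (near_open (@open_img p) ip) => x [y py <-].
    by rewrite /f /= chartK.
  have [_ K] := has_diff_near nE H.
  exact: (congr1 (@^~ v) K).
under eq_bigr => i _.
  rewrite (lc_leibniz hD v (@open_dom p) (sf i) (smooth_coord p _) pp) tf.
  rewrite coord_field_id; over.
rewrite big_split /= -row_sum_delta; congr (_ + _).
rewrite (linear_rVE _ (cg_linearr (chart_geometryP p) v ip)).
apply: eq_bigr => i _; congr (_ *: _).
by have := coord_christoffel v (delta_mx 0 i) pp; rewrite !coord_field_id.
Qed.

Lemma curvatureE p u v w :
  curvature D p u v w = chart_curvature (christoffel p) (chart p p) u v w.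
Proof.
have pp := cdom_self p; have ip : (chart p @` cdom p) (chart p p) by exists p.
rewrite /curvature /curvature_field lie_coord_field //.
rewrite (linear_fun0 (D_linear w pp)) sub0r !coord_field_id.
have DD a b c : D p a (fun q => D q (coord_field p b q) (coord_field p c)) =
  'd (fun x => christoffel p x b c) (chart p p) a +
  christoffel p (chart p p) a (christoffel p (chart p p) b c).
  have sc := cg_christoffel_smooth (chart_geometryP p) b c.
  rewrite -(D_chart_field a sc).
  (* The inner covariant derivative equals the chart field of its Christoffel components only on
     [cdom p], hence the appeal to locality. *)
  apply: (lc_local hD a (@open_dom p) (D_smooth p b c) _ pp) => q pq.
  by rewrite -coord_christoffel.
by rewrite !DD.
Qed.
End Geometry.

(** * Orthonormal expansions and frames *)

Section LinearAlgebra.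
Context (R : realType) (n : nat).
Implicit Types (b : 'rV[R]_n -> 'rV[R]_n -> R) (W : {vspace 'rV[R]_n}).

Lemma linfunE k (f : 'rV[R]_n -> 'rV[R]_k) v : linear f -> linfun f v = f v.
Proof.
move=> lf; pose F : {linear _ -> _} := HB.pack f
  (GRing.isLinear.Build _ _ _ _ _ lf).
exact: (lfunE F v).
Qed.

Lemma linfun_scalarE (f : 'rV[R]_n -> R^o) v : linear f -> linfun f v = f v.
Proof.
move=> lf; pose F : {linear _ -> _} := HB.pack f
  (GRing.isLinear.Build _ _ _ _ _ lf).
exact: (lfunE F v).
Qed.

Lemma linear_fun_sum (V' : normedModType R) (f : 'rV[R]_n -> V') (I : Type)
  (s : seq I) (F : I -> 'rV[R]_n) :
  linear f -> f (\sum_(i <- s) F i) = \sum_(i <- s) f (F i).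
Proof.
move=> lf; elim: s => [|i s IH]; first by rewrite !big_nil linear_fun0.
by rewrite !big_cons linear_funD // IH.
Qed.

Lemma orthonormal_expansion b W m (e : 'I_m -> 'rV[R]_n) w :
  (forall v, linear (fun u => b u v : R^o)) ->
    (forall i j, b (e i) (e j) = (i == j)%:R) ->
  (forall i, e i \in W) -> \dim W = m -> w \in W -> w = \sum_i b w (e i) *: e i.
Proof.
move=> lb oe eW dW wW.
have coefE (c : 'I_m -> R) i : b (\sum_j c j *: e j) (e i) = c i.
  rewrite (linear_fun_sum (f := fun u => b u (e i) : R^o)) //.
  rewrite (bigD1 i) //= (linear_funZ (lb _)) oe eqxx big1 ?addr0 => [|j ji].
    exact: mulr1.
  by rewrite (linear_funZ (lb _)) oe (negPf ji) scaler0.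
have fe : free [tuple e i | i < m].
  apply/freeP => c E i; rewrite -(coefE c i).
  have -> : \sum_j c j *: e j = 0.
    by rewrite -[RHS]E; apply: eq_bigr => j _; rewrite nth_mktuple.
  by rewrite (linear_fun0 (lb _)).
have be : basis_of W [tuple e i | i < m].
  rewrite basisEfree fe dW size_tuple leqnn andbT.
  by apply/span_subvP => v /tnthP[i ->]; rewrite tnth_mktuple.
rewrite [LHS](coord_basis be wW); apply: eq_bigr => i _.
rewrite nth_mktuple; congr (_ *: _).
rewrite -[LHS](coefE (fun i => coord [tuple e i | i < m] i w)).
congr (b _ _); rewrite [RHS](coord_basis be wW).
by apply: eq_bigr => j _; rewrite nth_mktuple.
Qed.

Lemma memv_bigcap_seq (I : Type) (s : seq I) (F : I -> {vspace 'rV[R]_n}) v :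
  (v \in (\bigcap_(i <- s) F i)%VS) = all (fun i => v \in F i) s.
Proof.
elim: s => [|i s IH]; first by rewrite big_nil memvf.
by rewrite big_cons memv_cap IH.
Qed.

(** Each further kernel lowers the dimension by at most one. For the functionals given by a basis of
    [W] this bounds the dimension of the orthogonal complement from below, which yields
    [orthv_full]. *)
Lemma dim_bigcap_ker (I : Type) (s : seq I) (phi : I -> 'Hom('rV[R]_n, R^o)) :
  (n <= \dim (\bigcap_(i <- s) lker (phi i)) + size s)%N.
Proof.
elim: s => [|i s IH]; first by rewrite big_nil dimvf addn0 /dim /= mul1n.
rewrite big_cons capvC; set A := (\bigcap_(_ <- _) _)%VS in IH *.
have := limg_ker_dim (phi i) A.
have : (\dim (phi i @: A) <= 1)%N.
  by rewrite (leq_trans (dimvS (subvf _))) // dimvf.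
by rewrite /=; move: IH => + + H; rewrite -H; lia.
Qed.

Section OrthogonalComplement.
Context (b : 'rV[R]_n -> 'rV[R]_n -> R) (W : {vspace 'rV[R]_n}).
Hypothesis bC : forall u v, b u v = b v u.
Hypothesis lb : forall v, linear (fun u => b u v : R^o).
Hypothesis bpos : forall u, u != 0 -> 0 < b u u.

Let lb2 u : linear (b u : _ -> R^o).
Proof. by move=> a v w; rewrite !(bC u) (lb u). Qed.

Lemma orthvP v : reflect (forall w, w \in W -> b w v = 0) (v \in orthv b W).
Proof.
apply: (iffP idP) => [|h].
  rewrite memv_bigcap_seq => /allP h w wW.
  rewrite (coord_vbasis wW) (linear_fun_sum (f := fun u => b u v : R^o)) //.
  rewrite big1 // => i _; rewrite (linear_funZ (lb _)).
  have := h _ (mem_nth 0 (n := i) _); rewrite size_tuple => /(_ (ltn_ord i)).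
  rewrite memv_ker linfun_scalarE // => /eqP ->.
  exact: scaler0.
rewrite memv_bigcap_seq; apply/allP => w ws.
by rewrite memv_ker linfun_scalarE // h // (vbasis_mem ws).
Qed.

Lemma orthv_direct : (orthv b W :&: W = 0)%VS.
Proof.
apply/eqP; rewrite -subv0; apply/subvP => v;
  rewrite memv_cap => /andP[/orthvP h vW].
rewrite memv0; apply/negP => /negP v0; have := bpos v0.
by rewrite h // ltxx.
Qed.

Lemma orthv_full : (orthv b W + W = fullv)%VS.
Proof.
apply/eqP; rewrite eqEdim subvf dimv_disjoint_sum ?orthv_direct // dimvf /dim
  /= mul1n.
have := dim_bigcap_ker (vbasis W) (fun u => linfun (fun v => b u v : R^o)).
by rewrite size_tuple.
Qed.
End OrthogonalComplement.
End LinearAlgebra.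

Lemma Ck_local (R : realType) (V W : normedModType R) k (U : set V)
  (f : V -> W) :
  (forall x, U x -> exists2 U', U' x & Ck_on k U' f) -> Ck_on k U f.
Proof.
elim: k f => [|k IH] f h /=; first by move=> x /h[U' U'x]; exact.
split=> [x /h[U' U'x [+ _]]|v]; first exact.
suff H x : U x -> exists2 U', U' x & Ck_on k U' (fun x => 'd f x v)
  by exact: IH H.
by move=> /h[U' U'x [_ Cf]]; exists U'; last exact: Cf.
Qed.

(** * Smooth Gram-Schmidt orthonormalisation *)

Section GramSchmidt.
Context (R : realType) (n : nat) (U : set 'rV[R]_n).
Context (g : 'rV[R]_n -> 'rV[R]_n -> 'rV[R]_n -> R).
Context (G : 'rV[R]_n -> 'rV[R]_n -> 'rV[R]_n -> 'rV[R]_n).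
Hypotheses (oU : open U) (cg : chart_geometry U g G).
Local Notation field := ('rV[R]_n -> 'rV[R]_n).

Lemma Ck_metric k (Y Z : field) U' : open U' -> U' `<=` U ->
  Ck_on k U' Y -> Ck_on k U' Z -> Ck_on k U' (fun x => g x (Y x) (Z x) : R^o).
Proof.
move=> oU' sU CY CZ.
apply: (Ck_lin_app (phi := fun x => g x (Y x) : _ -> R^o)) => // [x /sU Ux|w].
  exact: (cg_linear2 cg).
apply: (Ck_lin_app (phi := fun x v => g x v w : R^o)) => // [x /sU Ux|v].
  exact: (cg_linear cg).
exact: Ck_subset (cg_smooth cg v w k).
Qed.

(** Freeness at the single point [x0] suffices: each orthogonalised field is nonzero there, so its
    norm stays positive on a neighbourhood, to which the domain shrinks. The span clause later keeps
    frames horizontal. *)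
Lemma gram_schmidt x0 (s : seq field) : U x0 ->
  (forall i, smooth_on U (nth (fun=> 0) s i)) -> free [seq Y x0 | Y <- s] ->
  exists U' (e : seq field),
    [/\ open U', U' `<=` U, U' x0, size e = size s &
        (forall i, smooth_on U' (nth (fun=> 0) e i)) /\
        forall x, U' x ->
          (forall i j, (i < size e)%N -> (j < size e)%N ->
             g x (nth (fun=> 0) e i x) (nth (fun=> 0) e j x) = (i == j)%:R) /\
          (forall i, nth (fun=> 0) e i x \in <<[seq Y x | Y <- s]>>%VS)].
Proof.
move=> Ux0; elim: s => [|Y s IH] sY /=.
  move=> _; exists U, [::]; split=> //; split; first exact: sY.
  by move=> x Ux; split=> // i; rewrite nth_nil mem0v.
rewrite free_cons => /andP[Ynot fs].
have [|U1 [e [oU1 sU1 U1x0 se [smE oe]]]] := IH _ fs; first by move=> i;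
  exact: (sY i.+1).
pose Z x := Y x - \sum_(i < size e) g x (Y x) (nth (fun=> 0) e i x) *: nth
  (fun=> 0) e i x.
have smY : smooth_on U1 Y by move=> k; exact: Ck_subset sU1 (sY 0 k).
have smZ : smooth_on U1 Z.
  move=> k; apply: CkB => //; apply: Ck_sum => // i.
  apply: (Ck_scale (f := fun x => g x (Y x) (nth (fun=> 0) e i x))) => //.
    by apply: Ck_metric => //; exact: smE.
  exact: smE.
have espan x i : U1 x -> nth (fun=> 0) e i x \in <<[seq Y x | Y <- s]>>%VS.
  by move=> /oe[_]; exact.
have Z0 : Z x0 != 0.
  apply: contra Ynot => /eqP/(canRL (subrK _)); rewrite add0r => ->.
  by apply: memv_suml => i _; apply: memvZ; exact: espan.
have gZ0 : 0 < g x0 (Z x0) (Z x0) by apply: (cg_pos cg).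
have cZ : {for x0, continuous (fun x => g x (Z x) (Z x) : R^o)}.
  exact: (Ck_metric (k := 0) oU1 sU1 (smZ 0) (smZ 0)).
have nZ : \forall x \near x0, 0 < g x (Z x) (Z x).
  exact: (cvgr_gt _ cZ _ gZ0).
(* The interior is open by construction, and [nZ] puts [x0] in it. *)
pose U2 := U1 `&` [set x | 0 < g x (Z x) (Z x)]°.
have oU2 : open U2 by apply: openI => //; exact: open_interior.
have U2p x : U2 x -> 0 < g x (Z x) (Z x) by move=> [_ /interior_subset].
pose e0 x := (Num.sqrt (g x (Z x) (Z x)))^-1 *: Z x.
have sU2 : U2 `<=` U by move=> x [/sU1].
have sme0 : smooth_on U2 e0.
  move=> k; have CZ : Ck_on k U2 Z by apply: Ck_subset (smZ k) => x [].
  apply: (Ck_scale (f := fun x => (Num.sqrt (g x (Z x) (Z x)))^-1 : R^o)) => //.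
  apply: CkV => // [x Ux|].
    by rewrite gt_eqF // sqrtr_gt0 U2p.
  by apply: Ck_sqrt => //; exact: Ck_metric.
have Zorth x i : U1 x -> (i < size e)%N -> g x (Z x) (nth (fun=> 0) e i x) = 0.
  move=> U1x ie; have Ux := sU1 _ U1x; have [oex _] := oe _ U1x.
  rewrite (cgB cg) // (linear_fun_sum _ _ (cg_linear cg _ Ux)).
  rewrite (bigD1 (Ordinal ie)) //= (cgZ cg) // oex // eqxx mulr1 big1 ?addr0
    ?subrr // => j ji.
  rewrite (cgZ cg) // oex //; case: eqP => [E|_]; last by rewrite mulr0.
  by move: ji; rewrite -val_eqE /= E eqxx.
exists U2, (e0 :: e); split => //=.
  by rewrite se.
split=> [[|i] /=|]; first exact: sme0.
  by move=> k; apply: Ck_subset (smE i k) => x [].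
move=> x U2x; have Ux := sU2 _ U2x; have U1x : U1 x by case: U2x.
have [oex _] := oe _ U1x; split.
  have e0i i : (i < size e)%N -> g x (e0 x) (nth (fun=> 0) e i x) = 0.
    by move=> ie; rewrite (cgZ cg) // Zorth // mulr0.
  move=> [|i] [|j] //= ie je.
  - rewrite (cgZ cg) // (cg_sym cg) // (cgZ cg) //.
    have s0 := U2p _ U2x; have sn : Num.sqrt (g x (Z x) (Z x)) != 0.
      by rewrite gt_eqF // sqrtr_gt0.
    by rewrite -{3}(sqr_sqrtr (ltW s0)) expr2 !mulKf ?mulVf.
  - by rewrite e0i.
  - by rewrite (cg_sym cg) // e0i.
  - by rewrite oex.
have sub : (<<[seq Y x | Y <- s]>> <= <<Y x :: [seq Y x | Y <- s]>>)%VS.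
  by rewrite span_cons addvSr.
have eS i : nth (fun=> 0) e i x \in <<Y x :: [seq Y x | Y <- s]>>%VS.
  by apply: (subvP sub); exact: espan.
move=> [|i] /=; last exact: eS.
apply: memvZ; apply: memvB; first by rewrite memv_span ?mem_head.
by apply: memv_suml => i _; apply: memvZ.
Qed.
End GramSchmidt.

(** * Riemannian submersions in charts *)

Lemma chart_geometry_subset (R : realType) n (U U' : set 'rV[R]_n) g G :
  U' `<=` U -> chart_geometry U g G -> chart_geometry U' g G.
Proof.
move=> sU [h1 h2 h3 h4 h5 h6 h7 h8 h9]; split.
- by move=> x u v /sU; exact: h1.
- by move=> x u /sU; exact: h2.
- by move=> x u /sU; exact: h3.
- by move=> u v k; exact: Ck_subset sU (h4 u v k).
- by move=> x u /sU; exact: h5.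
- by move=> x u /sU; exact: h6.
- by move=> x u v /sU; exact: h7.
- by move=> u v k; exact: Ck_subset sU (h8 u v k).
- by move=> x u v w /sU; exact: h9.
Qed.

Section Submersion.
Context (R : realType) (n k : nat) (M : manifold R n) (N : manifold R k).
Context (gM : M -> 'rV[R]_n -> 'rV[R]_n -> R)
  (gN : N -> 'rV[R]_k -> 'rV[R]_k -> R).
Context (f : M -> N).
Hypotheses (hgM : riemannian_metric gM) (hgN : riemannian_metric gN).
Hypothesis (hf : riemannian_submersion gM gN f).
Implicit Types (p q y : M) (u v w : 'rV[R]_n).

Lemma riemannian_pos q u : u != 0 -> 0 < gM q u u.
Proof. by case: hgM => _ _ h _; exact: h. Qed.

Lemma tmapE p v : tmap f p v = 'd ((chart (f p) \o f) \o cinv p) (chart p p) v.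
Proof. by rewrite /tmap linfunE // => a u w; rewrite /tder linearP. Qed.

Lemma mem_ver p v : (v \in ver f p) = (tmap f p v == 0).
Proof. exact: memv_ker. Qed.

Lemma mem_hor p v : reflect (forall w, w \in ver f p -> gM p w v = 0)
  (v \in hor gM f p).
Proof.
apply: orthvP; [exact: (riemannian_sym hgM p) |
  exact: (riemannian_linear hgM p)].
Qed.

Lemma hor_direct p : (hor gM f p :&: ver f p = 0)%VS.
Proof.
apply: orthv_direct; [exact: (riemannian_sym hgM p) |
  exact: (riemannian_linear hgM p) | exact: riemannian_pos].
Qed.

Lemma hor_full p : (hor gM f p + ver f p = fullv)%VS.
Proof.
apply: orthv_full; [exact: (riemannian_sym hgM p) |
  exact: (riemannian_linear hgM p) | exact: riemannian_pos].
Qed.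

Lemma hproj_hor p u : hproj gM f p u \in hor gM f p.
Proof. exact: memv_pi. Qed.

Lemma hproj_ver p u : u - hproj gM f p u \in ver f p.
Proof.
have E := daddv_pi_add (hor_direct p) (w := u).
rewrite -[in X in X - _]E ?hor_full ?memvf // addrAC subrr add0r.
exact: memv_pi.
Qed.

Lemma hproj_id p u : u \in hor gM f p -> hproj gM f p u = u.
Proof. by move=> hu; rewrite /hproj daddv_pi_id ?hor_direct. Qed.

Lemma tmap_hproj p u : tmap f p (hproj gM f p u) = tmap f p u.
Proof.
have := hproj_ver p u; rewrite mem_ver linearB /= subr_eq0 => /eqP ->.
by [].
Qed.

Lemma metric_hor_ver p u v : u \in hor gM f p -> v \in ver f p -> gM p u v = 0.
Proof. by move=> /mem_hor h /h; rewrite (riemannian_sym hgM). Qed.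

Lemma metric_hproj p u v : u \in hor gM f p ->
  gM p u (hproj gM f p v) = gM p u v.
Proof.
move=> hu; rewrite -[in RHS](subrK (hproj gM f p v) v) [in RHS]addrC.
rewrite (linear_funD (riemannian_linearr hgM p u)).
by rewrite (metric_hor_ver hu (hproj_ver p v)) addr0.
Qed.

Lemma tmap_metric p u v :
  gN (f p) (tmap f p u) (tmap f p v) = gM p (hproj gM f p u) v.
Proof.
case: hf => _ _ _ _ iso; rewrite -(tmap_hproj p u) -(tmap_hproj p v).
by rewrite iso ?hproj_hor // metric_hproj // hproj_hor.
Qed.

Lemma tmap_surj p (w : 'rV[R]_k) : exists u, tmap f p u = w.
Proof.
case: hf => _ _ _ /(_ p) E _.
have : w \in limg (tmap f p) by rewrite E memvf.
by move=> /memv_imgP[u _ ->]; exists u.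
Qed.

Lemma tmap_hlift p (w : 'rV[R]_k) : tmap f p (hlift gM f p w) = w.
Proof.
rewrite /hlift tmap_hproj limg_lfunVK //.
by case: hf => _ _ _ ->; rewrite memvf.
Qed.

Definition sub_dom p : set M := cdom p `&` f @^-1` cdom (f p).

Definition sub_chart p := chart (f p) \o f \o cinv p.

Definition sub_proj p x u :=
  transd (cinv p x) p (cinv p x)
    (hproj gM f (cinv p x) (coord_field p u (cinv p x))).

Let contf : continuous f. Proof. by case: hf => _ []. Qed.

Lemma sub_preimage_open q : open (f @^-1` cdom (f q)).
Proof. by apply: open_comp => [x _|]; [exact: contf | exact: cdom_open]. Qed.

Lemma sub_dom_self p : sub_dom p p. Proof. by split; exact: cdom_self. Qed.

Lemma sub_img_open p : open (chart p @` sub_dom p).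
Proof. exact: (chart_image_open (sub_preimage_open p)). Qed.

Lemma sub_chart_smooth p : smooth_on (chart p @` sub_dom p) (sub_chart p).
Proof. by case: hf => _ [_ h] _ _ _; exact: h. Qed.

Lemma sub_chart_diff p y : sub_dom p y ->
  has_diff (sub_chart p) (chart p y) ('d (sub_chart p) (chart p y)).
Proof. by move=> py; apply: (CkS_diff (sub_chart_smooth p 1)); exists y. Qed.

Lemma tmap_coord_field p y u : sub_dom p y ->
  tmap f y (coord_field p u y) =
  coord_field (f p) ('d (sub_chart p) (chart p y) u) (f y).
Proof.
move=> [py fy].
have sy : has_diff ((chart (f y) \o f) \o cinv y) (chart y y)
    ('d ((chart (f y) \o f) \o cinv y) (chart y y)).
  exact: (sub_chart_diff (sub_dom_self y)).
have H := has_diff_change_chart py (cdom_self y) sy.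
have E : \forall x \near chart p y, (chart (f y) \o cinv (f p)) (sub_chart p x)
  =
    (chart (f y) \o f \o cinv p) x.
  apply: filterS (near_chart (sub_preimage_open p) py fy) => x
    /chart_image_cinv[_ fx _].
  by rewrite /sub_chart /= chartK.
have H' : has_diff (chart (f y) \o cinv (f p)) (sub_chart p (chart p y))
  (transd (f p) (f y) (f y)).
  rewrite /sub_chart /= chartK //; apply: has_diff_transd => //;
    exact: cdom_self.
have K := has_diff_near E (has_diff_comp (sub_chart_diff (conj py fy)) H').
rewrite tmapE; exact: (esym (has_diff_unique K H u)).
Qed.

Lemma sub_projE p y u : cdom p y ->
  coord_field p (sub_proj p (chart p y) u) y = hproj gM f y (coord_field p u y).
Proof.
move=> py; rewrite /sub_proj chartK //.
exact: (coord_field_comp (fun q => hproj gM f q (coord_field p u q)) py).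
Qed.

Lemma sub_proj_self p u : sub_proj p (chart p p) u = hproj gM f p u.
Proof. by have := sub_projE u (cdom_self p); rewrite !coord_field_id. Qed.

Lemma chart_submersionP p :
  chart_submersion (chart p @` sub_dom p) (chart (f p) @` cdom (f p))
    (chart_metric gM p) (chart_metric gN (f p)) (sub_chart p)
    (fun x => 'd (sub_chart p) x) (sub_proj p).
Proof.
have DP y u : sub_dom p y -> 'd (sub_chart p) (chart p y)
  (sub_proj p (chart p y) u) =
    'd (sub_chart p) (chart p y) u.
  move=> [py fy]; apply: (coord_field_inj fy).
  by rewrite -!tmap_coord_field // sub_projE // tmap_hproj.
split.
- by move=> x [y [py fy] <-]; exists (f y) => //; rewrite /sub_chart /= chartK.
- by move=> x [y py <-]; exact: sub_chart_diff.
- move=> x w [y py <-].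
  have [z zE] := tmap_surj y (coord_field (f p) w (f y)).
  exists (transd y p y z); apply: (coord_field_inj py.2).
  rewrite -tmap_coord_field // -zE; congr (tmap f y _).
  exact: (coord_field_comp (fun=> z) py.1).
- move=> x [y [py _] <-] a u v; rewrite /sub_proj chartK //.
  by rewrite linear_coord_field linearP linear_transd.
- by move=> x u [y py <-]; exact: DP.
- move=> x u v [y [py fy] <-].
  have e : sub_chart p (chart p y) = chart (f p) (f y) by rewrite /sub_chart /=
    chartK.
  rewrite e /chart_metric !chartK // -!tmap_coord_field // tmap_metric.
  by rewrite sub_projE.
Qed.

Context (DM : M -> 'rV[R]_n -> (M -> 'rV[R]_n) -> 'rV[R]_n).
Context (DN : N -> 'rV[R]_k -> (N -> 'rV[R]_k) -> 'rV[R]_k).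
Hypotheses (hDM : levi_civita gM DM) (hDN : levi_civita gN DN).

Lemma sub_geometry p :
  chart_geometry (chart p @` sub_dom p) (chart_metric gM p) (christoffel DM p).
Proof.
apply: (chart_geometry_subset (U := chart p @` cdom p));
  last exact: chart_geometryP.
by move=> x [y [py _] <-]; exists y.
Qed.

(** [hproj] is chosen pointwise from a decomposition into subspaces and carries no regularity. In a
    smooth orthonormal frame E_i the coefficients of P v are g(P v, E_i) = h(DF v, DF E_i), and the
    last expression is smooth and free of P. *)
Lemma sub_proj_smooth p v : smooth_on (chart p @` sub_dom p) (sub_proj p ^~ v).
Proof.
have cs := chart_submersionP p; have cg := sub_geometry p.
have ch := chart_geometryP hgN hDN (f p).
move=> m; apply: Ck_local => x0 Ux0.
(* Valid for every index: beyond the end the default constant field 0 matches the default vector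
   0. *)
have nthE i : nth (fun=> 0) [seq (fun=> b) | b <- vbasis (@fullv _ 'rV[R]_n)] i
  =
    (fun _ : 'rV[R]_n => nth 0 (vbasis (@fullv _ 'rV[R]_n)) i).
  by elim: (tval _) i => [|b l IH] [|i] //=.
have [i r||U' [e [oU' sU' U'x0 se [sme oe]]]] :=
  gram_schmidt (s := [seq (fun=> b) | b <- vbasis fullv]) (@sub_img_open p) cg
    Ux0.
- by rewrite nthE; apply: Ck_cst; exact: sub_img_open.
- by rewrite -map_comp map_id; exact: basis_free (vbasisP _).
exists U' => //; pose E (i : 'I_(size e)) := nth (fun=> 0) e i.
pose F := sub_chart p.
apply: (Ck_ext (f := fun x => \sum_i
  (chart_metric gN (f p) (F x) ('d F x v) ('d F x (E i x))) *: E i x)) => //.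
  move=> x U'x; have Ux := sU' _ U'x; have [oex _] := oe _ U'x.
  rewrite [RHS](orthonormal_expansion (b := chart_metric gM p x) (W := fullv)
    (e := fun i => E i x)).
  - by apply: eq_bigr => i _; rewrite (cs_isometry cs).
  - by move=> w; exact: (cg_linear cg).
  - by move=> i j; exact: oex.
  - by move=> i; exact: memvf.
  - by rewrite se size_map size_tuple.
  - exact: memvf.
have sF := sub_chart_smooth p.
have lh x (w : 'rV[R]_k) : U' x -> linear (fun u : 'rV[R]_k => chart_metric gN
  (f p) (F x) u w : R^o).
  by move=> U'x; apply: (cg_linear ch); apply: (cs_maps cs); exact: sU'.
have CdF w r : Ck_on r U' (fun x => 'd F x w).
  by apply: Ck_subset sU' ((sF r.+1).2 w).
apply: Ck_sum => // i.
apply: (Ck_scale (f := fun x => chart_metric gN (f p) (F x) ('d F x v)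
  ('d F x (E i x)))) => //; last exact: sme.
have CdE : Ck_on m U' (fun x => 'd F x (E i x)).
  apply: (Ck_lin_app (phi := fun x => 'd F x)) => //; last exact: sme.
  by move=> x _ a u w; rewrite linearP.
apply: (Ck_lin_app (phi := fun x (w : 'rV[R]_k) => chart_metric gN (f p) (F x)
  ('d F x v) w : R^o)) => //.
  by move=> x U'x; apply: (cg_linear2 ch); apply: (cs_maps cs); exact: sU'.
move=> w; apply: (Ck_lin_app (phi := fun x (u : 'rV[R]_k) => chart_metric gN
  (f p) (F x) u w : R^o)) => //.
  by move=> x U'x; exact: lh.
move=> u; apply: (Ck_comp (U' := chart (f p) @` cdom (f p)) (f := F)
  (g := fun z => chart_metric gN (f p) z u w : R^o)) => //.
- exact: cimage_open.
- by move=> x U'x; apply: (cs_maps cs); exact: sU'.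
- exact: Ck_subset sU' (sF m).
- exact: (cg_smooth ch).
Qed.
End Submersion.

(** * O'Neill's formula *)

Section FieldONeill.
Context (R : realType) (n k : nat) (M : manifold R n) (N : manifold R k).
Context (gM : M -> 'rV[R]_n -> 'rV[R]_n -> R)
  (gN : N -> 'rV[R]_k -> 'rV[R]_k -> R).
Context (f : M -> N).
Context (DM : M -> 'rV[R]_n -> (M -> 'rV[R]_n) -> 'rV[R]_n).
Context (DN : N -> 'rV[R]_k -> (N -> 'rV[R]_k) -> 'rV[R]_k).
Hypotheses (hgM : riemannian_metric gM) (hgN : riemannian_metric gN).
Hypothesis (hf : riemannian_submersion gM gN f).
Hypotheses (hDM : levi_civita gM DM) (hDN : levi_civita gN DN).
Implicit Types (p q y : M).

Definition horizontal_on (V : set M) (X : M -> 'rV[R]_n) :=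
  [/\ open V, vsmooth V X & forall p, V p -> X p \in hor gM f p].

(* Twice the O'Neill tensor: the vertical part of the bracket of horizontal
   fields with values [u] and [v] at [p]. *)
Definition oneill2 p u v :=
  let xi := 'd (sub_proj gM f p ^~ v) (chart p p) u -
            'd (sub_proj gM f p ^~ u) (chart p p) v in
  xi - hproj gM f p xi.

Let in_sub p : (chart p @` sub_dom f p) (chart p p).
Proof. by exists p => //; exact: sub_dom_self. Qed.

Let sub_proj_diff p v : has_diff (sub_proj gM f p ^~ v) (chart p p)
  ('d (sub_proj gM f p ^~ v) (chart p p)).
Proof. exact: (CkS_diff (sub_proj_smooth hgM hgN hf hDM hDN p v 1) (in_sub p)).
Qed.

(** Differentiating P X = X: modulo horizontal vectors, the derivative of a horizontal field depends
    only on its value at [p]. This is why the vertical part of the bracket is tensorial. *)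
Let horizontal_diff V X p u : horizontal_on V X -> V p ->
  'd (comp_field p X \o cinv p) (chart p p) u =
  'd (sub_proj gM f p ^~ (X p)) (chart p p) u +
  hproj gM f p ('d (comp_field p X \o cinv p) (chart p p) u).
Proof.
move=> [oV sX hX] Vp; have pp := cdom_self p.
have cX : comp_field p X p = X p by rewrite comp_fieldE transd_id.
have dX : has_diff (comp_field p X \o cinv p) (chart p p)
    ('d (comp_field p X \o cinv p) (chart p p)).
  by apply: (CkS_diff (vsmooth_comp_field p sX 1)); exists p.
have cs := chart_submersionP hgM hf p.
have lP : \forall x \near chart p p, linear (sub_proj gM f p x).
  apply: filterS (near_open (@sub_img_open _ _ _ _ _ _ _ _ hf p) (in_sub p)) =>
    x.
  exact: (cs_linear cs).
have H := has_diff_lin_app lP (fun v => sub_proj_diff p v) dX.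
have E : \forall x \near chart p p,
    sub_proj gM f p x (comp_field p X (cinv p x)) = comp_field p X (cinv p x).
  apply: filterS (near_chart oV pp Vp) => x /chart_image_cinv[px Vx cx].
  apply: (coord_field_inj px); rewrite -{1}cx sub_projE //.
  by rewrite (coord_field_comp X px) hproj_id //; exact: hX.
have /= := has_diff_unique (has_diff_near E H) dX u.
by rewrite chartK // cX sub_proj_self.
Qed.

Lemma vertical_lie V X Y p : horizontal_on V X -> horizontal_on V Y -> V p ->
  lie X Y p - hproj gM f p (lie X Y p) = oneill2 p (X p) (Y p).
Proof.
move=> hX hY Vp; rewrite lieE /oneill2.
have hh w : hproj gM f p (hproj gM f p w) = hproj gM f p w.
  by rewrite hproj_id // hproj_hor.
have alg (a b c d : 'rV[R]_n) : a = c + hproj gM f p a -> b = d + hproj gM f p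
  b ->
    a - b - hproj gM f p (a - b) = c - d - hproj gM f p (c - d).
  move=> ha hb; have -> : c = a - hproj gM f p a by rewrite [X in X - _]ha
    addrK.
  have -> : d = b - hproj gM f p b by rewrite [X in X - _]hb addrK.
  have hB u v : hproj gM f p (u - v) = hproj gM f p u - hproj gM f p v
    by exact: linearB.
  rewrite !hB !hh !subrr subr0.
  by apply/rowP => i; rewrite !mxE; ring.
exact: (alg _ _ _ _ (horizontal_diff (X p) hY Vp)
  (horizontal_diff (Y p) hX Vp)).
Qed.

Lemma oneill_formula p u v : u \in hor gM f p -> v \in hor gM f p ->
  gM p (curvature DM p u v v) u -
    gN (f p) (curvature DN (f p) (tmap f p u) (tmap f p v) (tmap f p v))
      (tmap f p u) =
  3 / 4 * gM p (oneill2 p u v) (oneill2 p u v).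
Proof.
move=> hu hv; have pp := cdom_self p; have fp := cdom_self (f p).
have sF := sub_chart_smooth hf p.
have oU := @sub_img_open _ _ _ _ _ _ _ _ hf p.
have cg := sub_geometry f hgM hDM p.
have ch := chart_geometryP hgN hDN (f p).
have cs := chart_submersionP hgM hf p.
have Pid w : w \in hor gM f p -> sub_proj gM f p (chart p p) w = w.
  by move=> hw; rewrite sub_proj_self // hproj_id.
pose d2F (x u v : 'rV[R]_n) := 'd (fun z => 'd (sub_chart f p) z v) x u.
pose d3F (x u v w : 'rV[R]_n) := 'd (fun z => d2F z v w) x u.
have h1 (x w : 'rV[R]_n) : (chart p @` sub_dom f p) x ->
    has_diff (sub_proj gM f p ^~ w) x ('d (sub_proj gM f p ^~ w) x).
  exact: (CkS_diff (sub_proj_smooth hgM hgN hf hDM hDN p w 1)).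
have h2 (x w : 'rV[R]_n) : (chart p @` sub_dom f p) x ->
    has_diff (fun z => 'd (sub_chart f p) z w) x (d2F x ^~ w).
  exact: (CkS_diff (k := 0) ((sF 2).2 w)).
have h3 (x a w : 'rV[R]_n) : (chart p @` sub_dom f p) x ->
    has_diff (fun z => d2F z a w) x (fun u => d3F x u a w).
  exact: (CkS_diff (k := 0) (((sF 3).2 w).2 a)).
(* Both symmetries are instances of [diff2_sym]: for the coordinate map here, and for its derivative
   in a fixed direction next. *)
have h4 (x a w : 'rV[R]_n) : (chart p @` sub_dom f p) x -> d2F x a w = d2F x w
  a.
  by move=> Ux; exact: (diff2_sym w a oU (sF 2) Ux).
have h5 (x a b w : 'rV[R]_n) : (chart p @` sub_dom f p) x -> d3F x a b w = d3F
  x b a w.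
  move=> Ux; exact: (diff2_sym (f := fun z => 'd (sub_chart f p) z w) b a oU
    ((sF 3).2 w) Ux).
have := chart_oneill oU cg ch cs h1 h2 h3 h4 h5 (fun _ _ _ => erefl) (in_sub p)
  (Pid _ hu) (Pid _ hv).
have gE a b : chart_metric gM p (chart p p) a b = gM p a b.
  by rewrite /chart_metric chartK // !coord_field_id.
have FE : sub_chart f p (chart p p) = chart (f p) (f p) by rewrite /sub_chart
  /= chartK.
have hE a b : chart_metric gN (f p) (sub_chart f p (chart p p)) a b = gN
  (f p) a b.
  by rewrite FE /chart_metric chartK // !coord_field_id.
rewrite /= !gE hE FE -(curvatureE hgM hDM) -(curvatureE hgN hDN).
have tE a : 'd (sub_chart f p) (chart p p) a = tmap f p a by rewrite tmapE.
by rewrite !tE !sub_proj_self.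
Qed.
End FieldONeill.

(** * Horizontal frames *)

Section HorizontalFrames.
Context (R : realType) (n k : nat) (M : manifold R n) (N : manifold R k).
Context (gM : M -> 'rV[R]_n -> 'rV[R]_n -> R)
  (gN : N -> 'rV[R]_k -> 'rV[R]_k -> R).
Context (f : M -> N).
Context (DM : M -> 'rV[R]_n -> (M -> 'rV[R]_n) -> 'rV[R]_n).
Context (DN : N -> 'rV[R]_k -> (N -> 'rV[R]_k) -> 'rV[R]_k).
Hypotheses (hgM : riemannian_metric gM) (hgN : riemannian_metric gN).
Hypothesis (hf : riemannian_submersion gM gN f).
Hypotheses (hDM : levi_civita gM DM) (hDN : levi_civita gN DN).
Implicit Types (p q y : M).

Lemma chart_preimage_open p (U : set 'rV[R]_n) : open U ->
  open (cdom p `&` chart p @^-1` U).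
Proof.
move=> oU; rewrite openE => y [py Uy].
have nU : \forall y \near y, U (chart p y).
  exact: (chart_continuous py (open_nbhs_nbhs (conj oU Uy))).
have nD := open_nbhs_nbhs (conj (@cdom_open _ _ _ p) py).
by rewrite /interior /=; near=> z; split; near: z.
Unshelve. all: by end_near. Qed.

(** [v] enters as a direction of differentiation, where linearity is immediate, and as the projected
    vector, where it is linearity of the derivative of a linear family. *)
Lemma linear_oneill2 p u : linear (oneill2 gM f p u).
Proof.
move=> a v w; rewrite /oneill2.
have in_p : (chart p @` sub_dom f p) (chart p p) by exists p => //;
  exact: sub_dom_self.
have l1 x : linear (fun v => 'd (sub_proj gM f p ^~ v) (chart p p) x).
  apply: (has_diff_linear_family (phi := sub_proj gM f p)
    (dphi := fun v => 'd (sub_proj gM f p ^~ v) (chart p p)) x) => [|z].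
    apply: filterS (near_open (@sub_img_open _ _ _ _ _ _ _ _ hf p) in_p) => z.
    exact: (cs_linear (chart_submersionP hgM hf p)).
  exact: (CkS_diff (sub_proj_smooth hgM hgN hf hDM hDN p z 1) in_p).
have l2 x : linear ('d (sub_proj gM f p ^~ x) (chart p p)) by move=> b y z;
  exact: linearP.
have alg (S T A B C D : 'rV[R]_n) : S = a *: A + B -> T = a *: C + D ->
    S - T - hproj gM f p (S - T) =
    a *: (A - C - hproj gM f p (A - C)) + (B - D - hproj gM f p (B - D)).
  move=> -> ->; have -> : a *: A + B - (a *: C + D) = a *: (A - C) + (B - D).
    by apply/rowP => i; rewrite !mxE; ring.
  by rewrite linearP; apply/rowP => i; rewrite !mxE; ring.
exact: (alg _ _ _ _ _ _ (l1 u a v w) (l2 u a v w)).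
Qed.

Lemma oneill2_skew p u v : oneill2 gM f p u v = - oneill2 gM f p v u.
Proof.
have alg (A B : 'rV[R]_n) : A - B - hproj gM f p (A - B) =
    - (B - A - hproj gM f p (B - A)).
  by rewrite -(opprB B A) linearN; apply/rowP => i; rewrite !mxE; ring.
exact: alg.
Qed.

(** Gram-Schmidt is applied to the projections of constant fields taken from a basis of the
    horizontal space at [p]: they are horizontal at every point and at [p] reproduce that basis. *)
Lemma horizontal_frame_exists p l : \dim (hor gM f p) = l ->
  exists V (X : 'I_l -> M -> 'rV[R]_n),
    [/\ open V, V p & horizontal_frame gM f V X].
Proof.
move=> dl; have oU := @sub_img_open _ _ _ _ _ _ _ _ hf p.
have in_p : (chart p @` sub_dom f p) (chart p p) by exists p => //;
  exact: sub_dom_self.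
have cg := sub_geometry f hgM hDM p.
have cs := chart_submersionP hgM hf p.
pose F b x := sub_proj gM f p x b.
have F0 : F 0 = fun=> 0.
  by apply/funext => x; rewrite /F /sub_proj
    (linear_fun0 (linear_coord_field p _)) linear0
     (linear_fun0 (linear_transd _ _ _)).
have nthE i : nth (fun=> 0) [seq F b | b <- vbasis (hor gM f p)] i =
    F (nth 0 (vbasis (hor gM f p)) i).
  by elim: (tval _) i => [|b s IH] [|i] //=; rewrite F0.
have [i||U' [e [oU' sU' U'x0 se [sme oe]]]] :=
  gram_schmidt (s := [seq F b | b <- vbasis (hor gM f p)]) oU cg in_p.
- rewrite nthE; exact: (sub_proj_smooth hgM hgN hf hDM hDN p).
- have -> : [seq Y (chart p p) | Y <- [seq F b | b <- vbasis (hor gM f p)]] =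
      vbasis (hor gM f p).
    rewrite -map_comp -[RHS]map_id; apply/eq_in_map => b bs /=.
    by rewrite /F sub_proj_self // hproj_id // vbasis_mem.
  exact: basis_free (vbasisP _).
have {}se : size e = l by rewrite se size_map size_tuple.
pose E i := nth (fun=> 0) e i : 'rV[R]_n -> 'rV[R]_n.
exists (cdom p `&` chart p @^-1` U'), (fun i => chart_field p (E i)).
have oV := @chart_preimage_open p _ oU'.
split => //; first by split=> //; exact: cdom_self.
split=> [i|y [py U'y]].
  apply: (vsmooth_chart_field oV) => [z []//|r].
  by apply: Ck_subset (sme i r) => x [z [_ U'z] <-].
have [oex spe] := oe _ U'y; have Ux := sU' _ U'y.
have PE i : sub_proj gM f p (chart p y) (E i (chart p y)) = E i (chart p y).
  (* Being fixed by the projection means lying in the kernel of [L], a subspace, so it passes from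
     the projected fields to their span. *)
  pose L u := sub_proj gM f p (chart p y) u - u.
  have lL : linear L.
    move=> a u v; rewrite /L (cs_linear cs) //.
    by apply/rowP => j; rewrite !mxE; ring.
  have : E i (chart p y) \in lker (linfun L).
    move: (spe i); rewrite -map_comp; apply: (subvP _ _).
    apply/span_subvP => w /mapP[b _ ->]; rewrite memv_ker linfunE // /L /=.
    by rewrite (chart_proj_idem cg cs) // subrr.
  rewrite memv_ker linfunE // subr_eq0 => /eqP; exact.
split=> [i|i j].
  rewrite /chart_field -coord_fieldE -PE sub_projE //; exact: hproj_hor.
rewrite /chart_field -!coord_fieldE.
have := oex i j; rewrite se !ltn_ord => /(_ isT isT).
by rewrite /chart_metric chartK.
Qed.
End HorizontalFrames.

(** * The scalar curvature of the horizontal distribution *)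

Section SpaceForm.
Context (R : realType) (n k l : nat) (M : manifold R n) (N : manifold R k).
Context (gM : M -> 'rV[R]_n -> 'rV[R]_n -> R)
  (gN : N -> 'rV[R]_k -> 'rV[R]_k -> R).
Context (f : M -> N).
Context (DM : M -> 'rV[R]_n -> (M -> 'rV[R]_n) -> 'rV[R]_n).
Context (DN : N -> 'rV[R]_k -> (N -> 'rV[R]_k) -> 'rV[R]_k).
Context (E : M -> {vspace 'End('rV[R]_n)}) (c : R).
Hypothesis hM : quaternionic_space_form gM DM E c.
Hypothesis hgN : riemannian_metric gN.
Hypothesis (hf : riemannian_submersion gM gN f).
Hypothesis hDN : levi_civita gN DN.
Implicit Types (p q : M).

Let hgM : riemannian_metric gM. Proof. by case: hM => [[[]]]. Qed.
Let hDM : levi_civita gM DM. Proof. by case: hM => [[]]. Qed.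

Lemma admissible_skew U J p a u v : admissible_basis gM E U J -> U p ->
  gM p (J a p u) v = - gM p (J a p v) u.
Proof.
move=> hJ Up; rewrite -(ab_hermitian hJ a (J a p u) v Up) (ab_square hJ) //.
by rewrite (linear_funN (riemannian_linear hgM p _)) (riemannian_sym hgM).
Qed.

Lemma admissible_subset U V J : V `<=` U ->
  admissible_basis gM E U J -> admissible_basis gM E V J.
Proof.
move=> sV [h1 h2 h3 h4 h5 h6]; split.
- move=> a W X oW WV; apply: h1 => //; exact: subset_trans sV.
- by move=> p /sV; exact: h2.
- by move=> p a v /sV; exact: h3.
- by move=> p a v /sV; exact: h4.
- by move=> p a v /sV; exact: h5.
- by move=> p a u v /sV; exact: h6.
Qed.

(** The factor 3 is 1 + 2: by skewness of [J a p] both the second and the third term of the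
    curvature sum are multiples of the same square, while the first vanishes. *)
Lemma space_form_sectional U J p u v :
  open U -> admissible_basis gM E U J -> U p ->
  gM p (curvature DM p u v v) u =
  c / 4 * (gM p v v * gM p u u - gM p u v ^+ 2 +
           \sum_(a < 3) 3 * gM p (J a p u) v ^+ 2).
Proof.
move=> oU hJ Up; case: hM => _ /(_ U J p u v v oU hJ Up) ->.
have lg := riemannian_linear hgM p u.
have gZ a x : gM p (a *: x) u = a * gM p x u by exact: (linear_funZ lg).
have gD x y : gM p (x + y) u = gM p x u + gM p y u by exact: (linear_funD lg).
have gB x y : gM p (x - y) u = gM p x u - gM p y u by exact: (linear_funB lg).
have gS (F : 'I_3 -> 'rV[R]_n) : gM p (\sum_a F a) u = \sum_a gM p (F a) u.
  exact: (linear_fun_sum (f := fun x => gM p x u : R^o)).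
rewrite gZ gD gB !gZ gS (riemannian_sym hgM p v u) -expr2; congr (_ * (_ + _)).
apply: eq_bigr => a _; rewrite gD gB !gZ.
have s0 x : gM p (J a p x) x = 0 by have := admissible_skew a x x hJ Up; lra.
rewrite !s0 (admissible_skew a v u hJ Up); ring.
Qed.

Lemma hcurvature_metric p x y z u : u \in hor gM f p ->
  gM p (hcurvature gM DN f p x y z) u =
  gN (f p) (curvature DN (f p) (tmap f p x) (tmap f p y) (tmap f p z))
    (tmap f p u).
Proof.
move=> hu; rewrite /hcurvature; set w := curvature _ _ _ _ _.
rewrite -[in RHS](tmap_hlift hgM hf p w) (tmap_metric hgM hf).
by rewrite hproj_id // hproj_hor.
Qed.

(** The exact formula behind both claims: the deficit is a sum of squared norms of vertical
    vectors. *)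
Lemma hscalarE U J (X : 'I_l -> M -> 'rV[R]_n) p :
  open U -> admissible_basis gM E U J ->
  horizontal_frame gM f U X -> U p ->
  hscalar gM DN f X p =
  c / 4 * (l%:R * (l%:R - 1) +
    \sum_(i < l) \sum_(a < 3) 3 * normC2 gM f X (J a) p (X i p)) -
  3 / 4 * \sum_(i < l) \sum_(j < l)
    gM p (oneill2 gM f p (X i p) (X j p)) (oneill2 gM f p (X i p) (X j p)).
Proof.
move=> oU hJ [_ hX] Up; have [hXp oX] := hX p Up.
(* The projection inside [normC2] is invisible when paired with the horizontal vector [X j p]. *)
have nE a i : normC2 gM f X (J a) p (X i p) = \sum_(j < l) gM p (J a p (X i p))
  (X j p) ^+ 2.
  apply: eq_bigr => j _; congr (_ ^+ 2).
  by rewrite (riemannian_sym hgM) metric_hproj // (riemannian_sym hgM).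
(* The diagonal is not excluded from the sum: the term 1 minus the Kronecker delta vanishes there,
   whence l(l - 1) in place of l^2. *)
transitivity (\sum_(i < l) \sum_(j < l)
   (c / 4 * (1 - (i == j)%:R + \sum_(a < 3) 3 * gM p (J a p (X i p)) (X j p) ^+
     2) -
    3 / 4 * gM p (oneill2 gM f p (X i p) (X j p))
      (oneill2 gM f p (X i p) (X j p)))).
  apply: eq_bigr => i _; apply: eq_bigr => j _.
  rewrite hcurvature_metric //.
  have := oneill_formula hgM hgN hf hDM hDN (hXp i) (hXp j).
  rewrite (space_form_sectional _ _ oU hJ Up) !oX !eqxx mulr1.
  have -> : ((i == j)%:R : R) ^+ 2 = (i == j)%:R by case: eqP => _;
    rewrite ?expr1n ?expr0n.
  by move=> <-; rewrite subKr.
under eq_bigr => i _ do rewrite sumrB -!mulr_sumr.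
rewrite sumrB -!mulr_sumr; congr (_ * _ - _).
under eq_bigr => i _ do rewrite big_split /= sumrB.
rewrite big_split /=; congr (_ + _).
  have rowE (i : 'I_l) : \sum_(j < l) (i == j)%:R = 1 :> R.
    by rewrite (bigD1 i) //= eqxx big1 ?addr0 // => j /negPf;
      rewrite eq_sym => ->.
  under eq_bigr => i _ do rewrite rowE sumr_const card_ord.
  by rewrite sumr_const card_ord mulr_natl.
apply: eq_bigr => i _; rewrite exchange_big /=; apply: eq_bigr => a _.
by rewrite nE mulr_sumr.
Qed.
End SpaceForm.

(** * The inequality and the case of equality *)

Theorem theorem3p4 (R : realType) (m k l : nat)
  (M : manifold R (4 * m)) (N : manifold R k)
  (gM : M -> 'rV[R]_(4 * m) -> 'rV[R]_(4 * m) -> R)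
  (gN : N -> 'rV[R]_k -> 'rV[R]_k -> R)
  (DM : M -> 'rV[R]_(4 * m) -> (M -> 'rV[R]_(4 * m)) -> 'rV[R]_(4 * m))
  (DN : N -> 'rV[R]_k -> (N -> 'rV[R]_k) -> 'rV[R]_k)
  (E : M -> {vspace 'End('rV[R]_(4 * m))}) (c : R) (f : M -> N)
  (hM : quaternionic_space_form gM DM E c)
  (hgN : riemannian_metric gN) (hDN : levi_civita gN DN)
  (hf : riemannian_submersion gM gN f)
  (hanti : anti_invariant gM E f)
  (hl : forall p : M, \dim (hor gM f p) = l) :
  (forall (U : set M) (J : 'I_3 -> M -> 'End('rV[R]_(4 * m)))
     (X : 'I_l -> M -> 'rV[R]_(4 * m)),
     open U -> admissible_basis gM E U J -> horizontal_frame gM f U X ->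
     forall p, U p ->
       hscalar gM DN f X p <=
       c / 4 * (l%:R * (l%:R - 1) +
         \sum_(i < l) \sum_(a < 3) 3 * normC2 gM f X (J a) p (X i p)))
  /\
  ((forall (U : set M) (J : 'I_3 -> M -> 'End('rV[R]_(4 * m)))
      (X : 'I_l -> M -> 'rV[R]_(4 * m)),
      open U -> admissible_basis gM E U J -> horizontal_frame gM f U X ->
      forall p, U p ->
        hscalar gM DN f X p =
        c / 4 * (l%:R * (l%:R - 1) +
          \sum_(i < l) \sum_(a < 3) 3 * normC2 gM f X (J a) p (X i p)))
   <-> horizontal_integrable gM f).
Proof.
have [[[hgM adm] hDM _] _] := hM.
have g_ge0 p w : 0 <= gM p w w.
  have [->|w0] := eqVneq w 0; last exact: ltW (riemannian_pos hgM p w0).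
  by rewrite (linear_fun0 (riemannian_linear hgM p 0)).
have sum_ge0 p (X : 'I_l -> M -> 'rV[R]_(4 * m)) : 0 <= \sum_(i < l)
  \sum_(j < l)
    gM p (oneill2 gM f p (X i p) (X j p)) (oneill2 gM f p (X i p) (X j p)).
  by apply: sumr_ge0 => i _; apply: sumr_ge0 => j _; exact: g_ge0.
split=> [U J X oU hJ hX p Up|].
  rewrite (hscalarE hM hgN hf hDN oU hJ hX Up) gerBl.
  by rewrite mulr_ge0 // divr_ge0.
split=> [eq U X Y oU sX sY hX hY p Up|int U J X oU hJ hX p Up].
  have hXU : horizontal_on gM f U X by split.
  have hYU : horizontal_on gM f U Y by split.
  have := vertical_lie hgM hgN hf hDM hDN hXU hYU Up.
  suff -> : oneill2 gM f p (X p) (Y p) = 0.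
    by move=> /eqP; rewrite subr_eq0 => /eqP ->; exact: hproj_hor.
  (* The assumed equality speaks only of open sets carrying both an admissible basis and a
     horizontal frame, so one of each is produced near [p] and restricted to a common
     neighbourhood. *)
  have [U1 [J [oU1 U1p hJ]]] := adm p.
  have [V [Z [oV Vp [sZ hZ]]]] := horizontal_frame_exists hgM hgN hf hDM hDN
    (hl p).
  pose W := U1 `&` V; have oW : open W by exact: openI.
  have hJW : admissible_basis gM E W J.
    by apply: admissible_subset hJ => y [].
  have hZW : horizontal_frame gM f W Z.
    split=> [i|y [_ Vy]]; last exact: hZ.
    by apply: vsmooth_subset (sZ i) => y [].
  have Wp : W p by [].
  have [Zp oZ] := hZ p Vp.
  have := eq W J Z oW hJW hZW p Wp.
  rewrite (hscalarE hM hgN hf hDN oW hJW hZW Wp) => S0.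
  have {}S0 : \sum_(i < l) \sum_(j < l)
      gM p (oneill2 gM f p (Z i p) (Z j p)) (oneill2 gM f p (Z i p) (Z j p)) =
        0.
    by lra.
  (* A vanishing sum of nonnegative terms has all terms zero, and the metric is positive
     definite. *)
  have z0 i j : oneill2 gM f p (Z i p) (Z j p) = 0.
    have := S0 => /eqP; rewrite psumr_eq0 => [|a _]; last first.
      by apply: sumr_ge0 => b _; exact: g_ge0.
    move=> /allP/(_ i (mem_index_enum _)) /=.
    rewrite psumr_eq0 => [|b _]; last exact: g_ge0.
    move=> /allP/(_ j (mem_index_enum _)) /= /eqP gw.
    apply/eqP/negP => /negP w0; have := riemannian_pos hgM p w0.
    by rewrite gw ltxx.
  have ex w : w \in hor gM f p -> w = \sum_i gM p w (Z i p) *: Z i p.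
    exact: (orthonormal_expansion (riemannian_linear hgM p) oZ Zp (hl p)).
  have l2 u := linear_oneill2 hgM hgN hf hDM hDN p u.
  have zr i w : w \in hor gM f p -> oneill2 gM f p (Z i p) w = 0.
    move=> /ex ->; rewrite (linear_fun_sum _ _ (l2 _)) big1 // => j _.
    by rewrite (linear_funZ (l2 _)) z0 scaler0.
  (* Linearity is available in the second argument only; skewness moves each argument there in turn
     for its expansion in the frame. *)
  rewrite oneill2_skew (ex (X p)) ?hX // (linear_fun_sum _ _ (l2 _)) big1
    ?oppr0 // => j _.
  by rewrite (linear_funZ (l2 _)) oneill2_skew zr ?hY // oppr0 scaler0.
(* Conversely, the frame fields are themselves horizontal, so integrability makes their brackets
   horizontal and every term of the deficit zero. *)
rewrite (hscalarE hM hgN hf hDN oU hJ hX Up) [S in _ - _ * S]big1 ?mulr0 ?subr0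
  // => i _.
rewrite big1 // => j _.
have hXi a : horizontal_on gM f U (X a).
  by split => //; [exact: hX.1 | move=> y /(hX.2 _) []].
rewrite -(vertical_lie hgM hgN hf hDM hDN (hXi i) (hXi j) Up).
have [_ sXi hhi] := hXi i; have [_ sXj hhj] := hXi j.
rewrite (hproj_id hgM (int U (X i) (X j) oU sXi sXj hhi hhj p Up)) subrr.
by rewrite (linear_fun0 (riemannian_linear hgM p 0)).
Qed.
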